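(* Let $R$ be a normal ring of dimension $2$ with an irredundant $\mathbb{N}$-grading, where $R_0$ is an algebraically closed field (and $R$ is a finitely generated $R_0$-algebra). Set $X := \operatorname{Proj} R$, and let $D$ be a $\mathbb{Q}$-divisor on $X$ such that $R=\bigoplus_{n\geqslant 0} H^0(X,\mathcal{O}_X(nD))T^n$. Let $d$ be a positive integer. (1) Suppose $x\in R_d$ is a prime element. Set $$s := \gcd\{n\in\mathbb{N}\mid [R/xR]_n\neq 0\}.$$ Then the integers $d$ and $s$ are relatively prime, and the divisor $sdD$ is linearly equivalent to a point of $X$. In particular, $\deg D=1/(sd)$. (2) Conversely, suppose $dD$ is linearly equivalent to a point $P$ of $X$ with $P\notin\operatorname{supp}(\operatorname{frac}(D))$. Let $g$ be a rational function on $X$ with $$\operatorname{div}(g)=P-dD.$$ Then $x := gT^d$ is a prime element of $R$, and the induced grading on $R/xR$ is irredundant.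
   Context: Here $\mathbb{N}$ includes $0$. An $\mathbb{N}$-graded ring $R=\bigoplus_{n\geqslant 0}R_n$ is always assumed to be commutative and finitely generated as an algebra over $R_0$, with $R_0$ an algebraically closed field. An $\mathbb{N}$-grading on $R$ is called irredundant if $\gcd\{n\in\mathbb{N}\mid R_n\neq 0\}=1$; the same terminology applies to quotients of $R$ by homogeneous ideals, with the induced grading. For $R$ as in the claim (a normal domain of dimension $2$), $X=\operatorname{Proj}R$ is a normal projective curve over $R_0$; its function field $K(X)$ is the degree-zero part of the ring of fractions of $R$ by nonzero homogeneous elements. ''Point'' means closed point. A $\mathbb{Q}$-divisor on $X$ is a finite formal sum $D=\sum n_iV_i$ with $n_i\in\mathbb{Q}$ and $V_i$ distinct points of $X$. Its degree is $\deg D=\sum n_i$. Set $\lfloor D\rfloor=\sum\lfloor n_i\rfloor V_i$ and $\mathcal{O}_X(D):=\mathcal{O}_X(\lfloor D\rfloor)$. The divisor $D$ is effective, written $D\geqslant 0$, if all $n_i\geqslant 0$. For $g\in K(X)$ nonzero, $\operatorname{div}(g)$ is the usual divisor of zeros and poles. Thus $H^0(X,\mathcal{O}_X(D))=\{g\in K(X)\mid g=0\text{ or }\operatorname{div}(g)+D\geqslant 0\}$. The support of the fractional part is $\operatorname{supp}(\operatorname{frac}(D))=\{V_i\mid n_i\notin\mathbb{Z}\}$. Two $\mathbb{Q}$-divisors $D_1,D_2$ are linearly equivalent if $D_1-D_2=\operatorname{div}(g)$ for some nonzero $g\in K(X)$. In the equality $R=\bigoplus_{n\geqslant 0}H^0(X,\mathcal{O}_X(nD))T^n$,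 $T$ is a homogeneous element of degree $1$ in the fraction field of $R$ (transcendental over $K(X)$), so $R$ is a graded subring of $K(X)[T]$ and $R_n=H^0(X,\mathcal{O}_X(nD))T^n$ for each $n\geqslant 0$. Here $D$ is ample, i.e. $ND$ is an ample Cartier divisor for some positive integer $N$; given $T$, such a $D$ exists and is unique by a theorem of Demazure. *)

(* Defs.v *)
From HB Require Import structures.
From mathcomp Require Import all_boot all_order all_algebra.
From mathcomp Require Import all_classical.

Set Implicit Arguments.
Unset Strict Implicit.
Unset Printing Implicit Defensive.

Import Order.TTheory GRing.Theory Num.Theory.
Local Open Scope classical_set_scope.
Local Open Scope ring_scope.

Notation "x %:F" := (FracField.tofrac x) : ring_scope.

(* Greatest common divisor of an arbitrary set of naturals; ngcd set0 and     *)
(* ngcd [set 0] are 0.                                                        *)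
Definition is_ngcd (S : set nat) (m : nat) : Prop :=
  (forall n, S n -> (m %| n)%N) /\
  (forall e, (forall n, S n -> (e %| n)%N) -> (e %| m)%N).

Definition ngcd (S : set nat) : nat := xget 0%N (is_ngcd S).

Lemma ngcdP (S : set nat) : is_ngcd S (ngcd S).
Proof.
suff [m Sm] : exists m, is_ngcd S m.
  by rewrite /ngcd; case: xgetP => [? -> //|/(_ m)].
have [[n [Sn n_gt0]]|S0] := pselect (exists n, S n /\ (0 < n)%N); last first.
  exists 0%N; split=> [n Sn|e _]; last exact: dvdn0.
  by case: n Sn => // n Sn; case: S0; exists n.+1.
pose Q m := `[< (0 < m)%N /\
  forall e, (forall n, S n -> (e %| n)%N) -> (e %| m)%N >].
have exQ : exists m, Q m by exists n; apply/asboolP; split=> // e; apply.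
case: (ex_minnP exQ) => m /asboolP[m_gt0 mP] m_min.
exists m; split=> // i Si.
have : Q (gcdn m i).
  apply/asboolP; split; first by rewrite gcdn_gt0 m_gt0.
  by move=> e eS; rewrite dvdn_gcd mP // eS.
move=> /m_min le_m; apply/gcdn_idPl/eqP; rewrite eqn_leq le_m andbT.
by rewrite dvdn_leq // dvdn_gcdl.
Qed.

Section Rings.
Variable R : idomainType.
Implicit Types I P : {pred R}.

Definition prime_ideal I : Prop := idealr_closed I /\ prime_idealr_closed I.

Definition principal (x : R) : {pred R} :=
  [pred a | `[< exists c, a = c * x >]].

Definition prime_element (x : R) : Prop := x != 0 /\ prime_ideal (principal x).

Definition prime_chain (n : nat) (C : nat -> {pred R}) : Prop :=
  (forall i, (i <= n)%N -> prime_ideal (C i)) /\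
  (forall i, (i < n)%N ->
     {subset C i <= C i.+1} /\ ~ {subset C i.+1 <= C i}).

Definition krull_dim (n : nat) : Prop :=
  (exists C, prime_chain n C) /\ ~ (exists C, prime_chain n.+1 C).

Definition normal_domain : Prop :=
  forall f : {fraction R},
    integralOver (@FracField.tofrac R) f -> exists r : R, f = r%:F.

Definition fin_gen_algebra (k : nzRingType) (iota : k -> R) : Prop :=
  exists gs : seq R, forall A : {pred R}, subring_closed A ->
    (forall c, iota c \in A) -> {subset gs <= A} -> forall r, r \in A.

End Rings.

Section Graded.
Variables (R : idomainType) (G : nat -> {pred R}).

Record grading : Prop := Grading {
  grading_zmod : forall n, zmod_closed (G n);
  grading1 : 1 \in G 0%N;
  gradingM : forall m n a b,
    a \in G m -> b \in G n -> a * b \in G (m + n)%N;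
  grading_span : forall r, exists N (c : nat -> R),
    (forall i, c i \in G i) /\ r = \sum_(0 <= i < N) c i;
  grading_free : forall N (c : nat -> R), (forall i, c i \in G i) ->
    \sum_(0 <= i < N) c i = 0 -> forall i, (i < N)%N -> c i = 0 }.

(* The n such that [R/I]_n, i.e. the image of R_n in R/I, is nonzero. *)
Definition quot_degrees (I : {pred R}) : set nat :=
  [set n | exists2 a, a \in G n & a \notin I].

(* Irredundancy of the grading induced on R/I; I = 0 gives R itself. *)
Definition irredundant (I : {pred R}) : Prop := ngcd (quot_degrees I) = 1%N.

Definition homogeneous_ideal (I : {pred R}) : Prop :=
  forall N (c : nat -> R), (forall i, c i \in G i) ->
    \sum_(0 <= i < N) c i \in I -> forall i, (i < N)%N -> c i \in I.

(* Points of the scheme Proj R: homogeneous primes not containing R_+. *)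
Definition in_Proj (I : {pred R}) : Prop :=
  [/\ prime_ideal I, homogeneous_ideal I &
      exists n a, [/\ (0 < n)%N, a \in G n & a \notin I]].

(* The closed points are those with no proper specialization in Proj R. *)
Record proj_point := ProjPoint {
  point_ideal :> {pred R};
  point_in_Proj : in_Proj point_ideal;
  point_closed : forall I, in_Proj I ->
    {subset point_ideal <= I} -> {subset I <= point_ideal} }.

HB.instance Definition _ := gen_eqMixin proj_point.
HB.instance Definition _ := gen_choiceMixin proj_point.

(* Fractions of homogeneous elements, of degree m (including 0). *)
Definition homog_frac (m : nat) : set {fraction R} :=
  [set f | exists n a b,
    [/\ a \in G (m + n)%N, b \in G n, b != 0 & f = a%:F / b%:F]].

Definition function_field : set {fraction R} := homog_frac 0.

Definition local_ring (P : proj_point) : set {fraction R} :=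
  [set f | exists n a b,
    [/\ a \in G n, b \in G n, b \notin P & f = a%:F / b%:F]].

Definition local_max (P : proj_point) : set {fraction R} :=
  [set f | exists n a b,
    [/\ a \in G n, a \in P, b \in G n, b \notin P & f = a%:F / b%:F]].

Definition uniformizer (P : proj_point) (t : {fraction R}) : Prop :=
  local_max P = [set t * f | f in local_ring P].

Definition is_ord (P : proj_point) (g : {fraction R}) (n : int) : Prop :=
  exists t u, [/\ uniformizer P t, u != 0, local_ring P u,
                  local_ring P u^-1 & g = u * t ^ n].

(* Normalized valuation at P, for nonzero g in the function field; the value  *)
(* is meaningful when the local ring at P is a discrete valuation ring.       *)
Definition ord (P : proj_point) (g : {fraction R}) : int := xget 0 (is_ord P g).

(* A Q-divisor is a function on closed points with finite support. *)
Definition finite_support_div (D : proj_point -> rat) : Prop :=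
  finite_set [set P | D P != 0].

Definition scale_div (n : nat) (D : proj_point -> rat) : proj_point -> rat :=
  fun P => n%:R * D P.

Definition point_div (P : proj_point) : proj_point -> rat :=
  fun Q => (Q == P)%:R.

Definition sub_div (D1 D2 : proj_point -> rat) : proj_point -> rat :=
  fun P => D1 P - D2 P.

Definition principal_div (g : {fraction R}) : proj_point -> rat :=
  fun P => (ord P g)%:~R.

Definition degree (D : proj_point -> rat) : rat := \sum_(P \in setT) D P.

Definition frac_support (D : proj_point -> rat) : set proj_point :=
  [set P | D P \isn't a Num.int].

Definition lin_equiv (D1 D2 : proj_point -> rat) : Prop :=
  exists g, [/\ function_field g, g != 0 & sub_div D1 D2 = principal_div g].

(* H^0(X, O_X(D)) *)
Definition H0 (D : proj_point -> rat) : set {fraction R} :=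
  [set g | function_field g /\
           (g = 0 \/ forall P, 0 <= principal_div g P + D P)].

(* The open set X_f where the section f of O_X(E) generates, for an integral  *)
(* divisor E.                                                                 *)
Definition nonvanishing (E : proj_point -> rat) (f : {fraction R}) :
    set proj_point :=
  [set P | f != 0 /\ principal_div f P + E P = 0].

(* Ampleness of O_X(E), E integral, in the sense of EGA II 4.5: the X_f, for  *)
(* f a global section of a positive power, form a basis of the topology.  It  *)
(* suffices to refine the basic open sets D_+(a) of Proj R at closed points.  *)
Definition ample_Cartier (E : proj_point -> rat) : Prop :=
  (forall P, E P \is a Num.int) /\
  forall n a (P : proj_point), (0 < n)%N -> a \in G n -> a \notin P ->
    exists m f, [/\ (0 < m)%N, H0 (scale_div m E) f,
      nonvanishing (scale_div m E) f P &
      forall Q : proj_point, nonvanishing (scale_div m E) f Q -> a \notin Q].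

Definition ample (D : proj_point -> rat) : Prop :=
  exists2 N, (0 < N)%N & ample_Cartier (scale_div N D).

(* R = \bigoplus_n H^0(X, O_X(nD)) T^n inside the fraction field, degree by   *)
(* degree.                                                                    *)
Definition section_ring (D : proj_point -> rat) (T : {fraction R}) : Prop :=
  forall n (f : {fraction R}),
    (exists2 r, r \in G n & f = r%:F) <->
    (exists2 g, H0 (scale_div n D) g & f = g * T ^+ n).

End Graded.

(* Main.v *)
(** Let E_r be the effective divisor nD + div(r/T^n) of r in R_n; it is additive
    in r, r lies in the ideal of Q iff E_r(Q) > 0, and r is divisible by f in R
    iff E_r >= E_f.  If xR is prime it is the ideal of a closed point P of X,
    every homogeneous element is x^i a with a not in P, and s divides deg a;
    since R has fractions of degree 1, d and s are coprime, x^s b/c with b, c not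
    in P is a uniformizer at P, and the divisor of x is P/s.  Hence the function
    T^(sd)/x^s has divisor sdD - P.  Conversely, if E_x = P and D(P) is an integer,
    then E_a >= E_x for every homogeneous a in P, so xR is the ideal of P, and
    comparing with E_x = P/s gives s = 1.

    For the degree, it suffices that deg E_f = l for f in R_(l s d) outside P,
    because D is a difference of two divisors E_a.  The dimension of R_(j s d)
    grows by exactly 1 with each large j, since R_(j s d) modulo P is a line.
    Thus f R_((j-l) s d) has codimension l in R_(j s d) for large j; on the other
    hand it consists of the sections vanishing on E_f, and imposing one more zero
    cuts the dimension by exactly one, so its codimension is deg E_f.

    Instead of normality one uses that a point whose local ring has no uniformizer
    carries neither D nor any E_r, and that the local ring at any other
    point is a discrete valuation ring because R has dimension 2. *)
Require Import Defs.
From HB Require Import structures.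
From mathcomp Require Import all_boot all_order all_algebra.
From mathcomp Require Import all_classical.
From mathcomp Require Import zify lra.

Set Implicit Arguments.
Unset Strict Implicit.
Unset Printing Implicit Defensive.

Import Order.TTheory GRing.Theory Num.Theory.
Local Open Scope classical_set_scope.
Local Open Scope ring_scope.

(** * Numerical semigroups, linear dependence, prime ideals *)

Lemma ngcd_dvd (S : set nat) n : S n -> (ngcd S %| n)%N.
Proof. by case: (ngcdP S) => + _; apply. Qed.

Lemma dvd_ngcd (S : set nat) e :
  (forall n, S n -> (e %| n)%N) -> (e %| ngcd S)%N.
Proof. by case: (ngcdP S) => _; apply. Qed.

Lemma ngcd_gt0 (S : set nat) n : S n -> (0 < n)%N -> (0 < ngcd S)%N.
Proof. by move=> /ngcd_dvd/dvdn_gt0 h /h. Qed.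

Lemma ngcd_gt0P (S : set nat) :
  (0 < ngcd S)%N -> exists2 n, S n & (0 < n)%N.
Proof.
move=> s_gt0; apply/not_exists2P => S0.
have : ((ngcd S).+1 %| ngcd S)%N.
  apply: dvd_ngcd => n Sn; case: (S0 n) => //.
  by rewrite lt0n => /negP/negbNE/eqP ->.
by move=> /(dvdn_leq s_gt0); rewrite ltnn.
Qed.

Lemma semigroup_muln (S : set nat) :
  S 0%N -> (forall m n, S m -> S n -> S (m + n)%N) ->
  forall q n, S n -> S (q * n)%N.
Proof. by move=> S0 SD; elim=> // q IH n Sn; rewrite mulSn; apply: SD => //; exact: IH. Qed.

Lemma ngcd_semigroup (S : set nat) :
  S 0%N -> (forall m n, S m -> S n -> S (m + n)%N) -> (0 < ngcd S)%N ->
  exists M, forall m, (M <= m)%N -> (ngcd S %| m)%N -> S m.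
Proof.
move=> S0 SD s_gt0; have SM := semigroup_muln S0 SD.
pose Q m := `[< (0 < m)%N /\ exists b, S b /\ S (b + m)%N >].
have exQ : exists m, Q m.
  have [n Sn n_gt0] := ngcd_gt0P s_gt0.
  by exists n; apply/asboolP; split=> //; exists 0%N.
case: (ex_minnP exQ) => m /asboolP[m_gt0 [b [Sb Sbm]]] m_min.
have dvdm n : S n -> (m %| n)%N.
  move=> Sn; rewrite /dvdn eqn0Ngt; apply/negP => r_gt0.
  suff /m_min : Q (n %% m)%N by rewrite leqNgt ltn_pmod.
  apply/asboolP; split=> //; exists ((n %/ m) * (b + m))%N; split; first exact: SM.
  have -> : ((n %/ m) * (b + m) + n %% m = n + (n %/ m) * b)%N.
    by rewrite {3}(divn_eq n m); nia.
  by apply: SD => //; exact: SM.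
have ms : m = ngcd S.
  apply/eqP; rewrite eqn_dvd dvd_ngcd //=.
  by rewrite -(dvdn_addr _ (ngcd_dvd Sb)) ngcd_dvd.
rewrite -ms; exists (b * b)%N => N le_N /dvdnP[q Nq].
have /dvdnP[b' bb'] := dvdm _ Sb.
(* If [b = 0], then [m] itself lies in [S]. *)
have [b0|b'_gt0] := posnP b'.
  by rewrite Nq; apply: SM; move: Sbm; rewrite bb' b0.
have lt_r : (q %% b' < b')%N by rewrite ltn_pmod.
have le_u : (q %% b' <= q %/ b')%N.
  rewrite leq_divRL //; have : (b * b' <= q)%N.
    by rewrite -(leq_pmul2r m_gt0) -Nq -mulnA -bb'.
  apply: leq_trans; rewrite leq_mul2r (leq_trans (ltnW lt_r)) ?orbT // bb'.
  by rewrite leq_pmulr.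
have -> : N = ((q %/ b' - q %% b') * b + (q %% b') * (b + m))%N.
  rewrite Nq bb' {1}(divn_eq q b'); move: le_u; move: (q %/ b')%N (q %% b')%N => u r le_u.
  by rewrite -{1}(subnK le_u); move: (u - r)%N => v; nia.
by apply: SD; exact: SM.
Qed.

Section LinearDependence.
Variables (k : fieldType) (R : idomainType) (iota : {rmorphism k -> R}).

Definition lincomb n (c : 'I_n -> k) (v : 'I_n -> R) : R :=
  \sum_i iota (c i) * v i.

Lemma lincombD n c c' (v : 'I_n -> R) :
  lincomb (fun i => c i + c' i) v = lincomb c v + lincomb c' v.
Proof. by rewrite -big_split; apply: eq_bigr => i _; rewrite rmorphD mulrDl. Qed.

Lemma lincombZ n a c (v : 'I_n -> R) :
  lincomb (fun i => a * c i) v = iota a * lincomb c v.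
Proof. by rewrite mulr_sumr; apply: eq_bigr => i _; rewrite rmorphM mulrA. Qed.

Definition subspace (Z : set R) : Prop :=
  [/\ Z 0, forall a b, Z a -> Z b -> Z (a + b) &
      forall c a, Z a -> Z (iota c * a)].

Lemma subspace_sum Z (I : finType) (F : I -> R) : subspace Z ->
  (forall i, Z (F i)) -> Z (\sum_i F i).
Proof. by case=> Z0 ZD _ ZF; apply: big_ind. Qed.

Lemma subspace_lincomb Z n c (v : 'I_n -> R) : subspace Z ->
  (forall i, Z (v i)) -> Z (lincomb c v).
Proof. by move=> sZ Zv; apply: subspace_sum => // i; case: sZ => _ _; apply. Qed.

Lemma subspaceB Z a b : subspace Z -> Z a -> Z b -> Z (a - b).
Proof.
case=> Z0 ZD ZZ Za Zb; apply: ZD => //.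
by rewrite -mulN1r -(rmorph1 iota) -rmorphN; apply: ZZ.
Qed.

Lemma subspace0 : subspace [set 0].
Proof. by split=> [//|a b -> ->|c a ->] /=; rewrite ?addr0 ?mulr0. Qed.

(** The [p] by [q] matrix of coefficients modulo [Z] has a nonzero vector in its left kernel because
    [q < p]. *)
Lemma dependent_mod Z p q (e : 'I_q -> R) (v : 'I_p -> R) : subspace Z ->
  (forall j, exists c : 'I_q -> k, Z (v j - lincomb c e)) -> (q < p)%N ->
  exists2 u : 'I_p -> k, exists j, u j != 0 & Z (lincomb u v).
Proof.
move=> sZ /choice[A vA] ltqp.
pose M := \matrix_(j < p, i < q) A j i.
have : kermx M != 0.
  rewrite kermx_eq0 /row_free neq_ltn (leq_ltn_trans _ ltqp) //.
  exact: rank_leq_col.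
case/rowV0Pn => u /sub_kermxP uM u0.
exists (fun j => u 0 j).
  by apply/existsP; apply: contraNT u0 => /existsPn/= u0; apply/eqP/rowP => j;
     have := u0 j; rewrite negbK mxE => /eqP.
have -> : lincomb (fun j => u 0 j) v =
    lincomb (fun j => u 0 j) (fun j => v j - lincomb (A j) e).
  rewrite /lincomb -[LHS]subr0; under [RHS]eq_bigr do rewrite mulrBr.
  rewrite sumrB; congr (_ - _).
  under eq_bigr do rewrite mulr_sumr.
  rewrite exchange_big big1 //= => i _.
  under eq_bigr do rewrite mulrA -rmorphM.
  rewrite -mulr_suml -rmorph_sum.
  have := congr1 (fun B : 'rV_q => B 0 i) uM; rewrite !mxE => E.
  rewrite [X in iota X](_ : _ = 0) ?rmorph0 ?mul0r // -[RHS]E.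
  by apply: eq_bigr => j _; rewrite !mxE.
exact: subspace_lincomb.
Qed.

Definition indep (V : set R) n : Prop :=
  exists2 v : 'I_n -> R, forall i, V (v i) &
    forall c, lincomb c v = 0 -> forall i, c i = 0.

(** The spanning vectors need not lie in [V]: this only bounds the dimension from above. *)
Definition spanned (V : set R) n : Prop :=
  exists v : 'I_n -> R, forall r, V r -> exists c, r = lincomb c v.

Lemma indep_leq_spanned V p q : indep V p -> spanned V q -> (p <= q)%N.
Proof.
move=> [v Vv vI] [e eV]; rewrite leqNgt; apply/negP => lt_qp.
have [j|u [j]] := dependent_mod (e := e) (v := v) subspace0 _ lt_qp.
  by have [c ->] := eV _ (Vv j); exists c; rewrite /= subrr.
by move=> /= + /vI u0; rewrite u0 eqxx.
Qed.

Lemma indepS (V W : set R) n : V `<=` W -> indep V n -> indep W n.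
Proof. by move=> VW [v Vv vI]; exists v => // i; apply/VW. Qed.

Lemma indep_step W V n v : subspace W -> W `<=` V -> V v -> ~ W v ->
  indep W n -> indep V n.+1.
Proof.
move=> sW WV Vv Wv [w Ww wI].
exists (fun i => if unlift ord0 i is Some j then w j else v).
  by move=> i; case: unliftP => [j|] _ //; apply: WV.
move=> c; rewrite /lincomb big_ord_recl unlift_none.
under eq_bigr do rewrite liftK.
move=> c0.
have Wc : W (\sum_(i < n) iota (c (lift ord0 i)) * w i).
  exact: (@subspace_lincomb W n (fun i => c (lift ord0 i))).
have c00 : c ord0 = 0.
  apply/eqP/negPn/negP => c00; apply: Wv.
  have -> : v = iota (- (c ord0)^-1) *
      \sum_(i < n) iota (c (lift ord0 i)) * w i.
    have := c0 => /eqP; rewrite addrC addr_eq0 => /eqP ->.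
    by rewrite mulrN rmorphN mulNr opprK mulrA -rmorphM mulVf // rmorph1 mul1r.
  by case: sW => _ _; apply.
move=> i; case: (unliftP ord0 i) => [j|] -> //.
apply: (wI (fun j => c (lift ord0 j))).
by rewrite -[RHS]c0 c00 rmorph0 mul0r add0r.
Qed.

Lemma spanned_step W V n v :
  (forall r, V r -> exists c, W (r - iota c * v)) ->
  spanned W n -> spanned V n.+1.
Proof.
move=> WV [w wW].
exists (fun i => if unlift ord0 i is Some j then w j else v) => r /WV[c /wW[b rb]].
exists (fun i => if unlift ord0 i is Some j then b j else c).
rewrite /lincomb big_ord_recl unlift_none.
under eq_bigr do rewrite liftK.
by rewrite -[r](subrK (iota c * v)) rb addrC.
Qed.

Lemma indep_mul V W n f : f != 0 -> (forall r, V r -> W (f * r)) ->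
  indep V n -> indep W n.
Proof.
move=> f0 VW [v Vv vI]; exists (fun i => f * v i) => [i|c]; first exact: VW.
rewrite /lincomb; under eq_bigr do rewrite mulrCA.
rewrite -mulr_sumr => /eqP; rewrite mulf_eq0 (negPf f0) /= => /eqP; exact: vI.
Qed.

Lemma spanned_mul V W n f : (forall r, W r -> exists2 r', V r' & r = f * r') ->
  spanned V n -> spanned W n.
Proof.
move=> VW [v vV]; exists (fun i => f * v i) => r /VW[r' /vV[c ->] ->].
exists c; rewrite /lincomb mulr_sumr; apply: eq_bigr => i _.
by rewrite mulrCA.
Qed.

End LinearDependence.

Section PrimeIdeals.
Variable R : idomainType.
Implicit Types (I P : {pred R}) (a b r y : R).

Definition set_pred (A : set R) : {pred R} := [pred a | `[< A a >]].

Lemma set_predP (A : set R) a : reflect (A a) (a \in set_pred A).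
Proof. exact: asboolP. Qed.

Record ideal (I : set R) : Prop := Ideal {
  ideal0 : I 0;
  idealD : forall a b, I a -> I b -> I (a + b);
  idealM : forall a b, I b -> I (a * b) }.

Lemma ideal_bigcup (F : set (set R)) A : total_on F subset -> F A ->
  (forall B, F B -> ideal B) -> ideal (\bigcup_(B in F) B).
Proof.
move=> Ftot FA Fid; split; first by exists A => //; exact: (ideal0 (Fid _ FA)).
  move=> a b [B FB Ba] [C FC Cb]; have [BC|CB] := Ftot _ _ FB FC.
    by exists C => //; exact: (idealD (Fid _ FC) (BC _ Ba) Cb).
  by exists B => //; exact: (idealD (Fid _ FB) Ba (CB _ Cb)).
by move=> a b [B FB Bb]; exists B => //; apply: idealM => //; exact: Fid.
Qed.

(** By Zorn there is an ideal maximal among those that contain [I] and miss every power of [y]; such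
    an ideal is prime. *)
Lemma prime_ideal_avoiding (I : set R) y : ideal I -> (forall j, ~ I (y ^+ j)) ->
  exists P, [/\ prime_ideal P, forall a, I a -> a \in P & y \notin P].
Proof.
move=> Iid Iy.
(* The empty set is allowed so that the empty chain has an upper bound. *)
pose good (A : set R) := A = set0 \/ [/\ ideal A, I `<=` A & forall j, ~ A (y ^+ j)].
have [F Fgood Ftot|M [goodM Mmax]] := @Zorn_bigcup R good.
  have [[A [FA A0]]|Fnone] := pselect (exists A, F A /\ A <> set0); last first.
    left; apply/seteqP; split=> // r [B FB Br].
    by case: Fnone; exists B; split=> // B0; rewrite B0 in Br.
  right; pose F' := [set B | F B /\ B <> set0].
  have -> : \bigcup_(B in F) B = \bigcup_(B in F') B.
    apply/seteqP; split=> r [B FB Br]; last by exists B => //; case: FB.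
    by exists B => //; split=> // B0; rewrite B0 in Br.
  have F'good B : F' B -> [/\ ideal B, I `<=` B & forall j, ~ B (y ^+ j)].
    by move=> [FB B0]; have [] := Fgood _ FB.
  split.
  - apply: (@ideal_bigcup _ A) => //; last by move=> B /F'good[].
    by move=> B C [FB _] [FC _]; exact: Ftot.
  - move=> r Ir; exists A => //.
    by have [//|_ IA _] := F'good A; exact: IA.
  - by move=> j [B /F'good[_ _ By] /By].
have {goodM} [Mid IM My] : [/\ ideal M, I `<=` M & forall j, ~ M (y ^+ j)].
  case: goodM => [M0|//]; suff: False by [].
  apply: (Mmax I); last by right; split.
  by rewrite M0; split=> [r []|/(_ 0 (ideal0 Iid))[]].
(* By maximality, [M + aR] contains a power of [y]. *)
have Mstep a : ~ M a -> exists j m r, M m /\ y ^+ j = m + r * a.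
  move=> Ma; apply: contrapT => Ny.
  apply: (Mmax [set b | exists m r, M m /\ b = m + r * a]); last first.
    right; split.
    - split.
      + by exists 0, 0; split; [exact: (ideal0 Mid) | rewrite mul0r addr0].
      + move=> _ _ [m [r [Mm ->]]] [m' [r' [Mm' ->]]].
        exists (m + m'), (r + r'); split; first exact: idealD.
        by rewrite mulrDl addrACA.
      + move=> b _ [m [r [Mm ->]]]; exists (b * m), (b * r).
        by split; [exact: idealM | rewrite mulrDr mulrA].
    - by move=> b Ib; exists b, 0; split; [exact: IM | rewrite mul0r addr0].
    - by move=> j [m [r [Mm E]]]; apply: Ny; exists j, m, r.
  split=> [b Mb|/(_ a) Ma']; first by exists b, 0; rewrite mul0r addr0.
  apply: Ma; apply: Ma'; exists 0, 1; rewrite mul1r add0r.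
  by split => //; exact: (ideal0 Mid).
exists (set_pred M); split; last 2 first.
- by move=> a /IM Ma; apply/set_predP.
- by apply/set_predP => My1; apply: (My 1%N); rewrite expr1.
split.
  split; first by apply/set_predP; exact: (ideal0 Mid).
    by apply/set_predP => M1; apply: (My 0%N).
  move=> a u v /set_predP Mu /set_predP Mv; apply/set_predP.
  by apply: idealD => //; exact: idealM.
move=> u v /set_predP Muv; apply/orP.
have [Mu|/Mstep[i [m [r [Mm E]]]]] := pselect (M u); first by left; apply/set_predP.
have [Mv|/Mstep[j [m' [r' [Mm' E']]]]] := pselect (M v); first by right; apply/set_predP.
case: (My (i + j)%N); rewrite exprD E E'.
have -> : (m + r * u) * (m' + r' * v) =
  (m' + r' * v) * m + (r * u * m' + r * r' * (u * v)).
  rewrite mulrDl [m * _]mulrC [X in _ + X]mulrDr; congr (_ + (_ + _)).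
  by rewrite mulrACA.
by apply: idealD => //; [|apply: idealD => //]; exact: idealM.
Qed.

End PrimeIdeals.

(** * Homogeneous components *)

Section PrimeIdealTheory.
Variables (R : idomainType) (I : {pred R}).
Hypothesis pI : prime_ideal I.

Lemma prime_ideal0 : 0 \in I. Proof. by case: pI => [[]]. Qed.
Lemma prime_ideal1 : 1 \notin I. Proof. by case: pI => [[]]. Qed.

Lemma prime_idealD a b : a \in I -> b \in I -> a + b \in I.
Proof. by case: pI => [[_ _ h] _] aI bI; rewrite -[a]mul1r h. Qed.

Lemma prime_idealMr a b : b \in I -> a * b \in I.
Proof. by case: pI => [[I0 _ h] _] bI; rewrite -[_ * _]addr0 h. Qed.

Lemma prime_idealMl a b : a \in I -> a * b \in I.
Proof. by rewrite mulrC; exact: prime_idealMr. Qed.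

Lemma prime_idealN a : a \in I -> - a \in I.
Proof. by rewrite -mulN1r; exact: prime_idealMr. Qed.

Lemma prime_idealB a b : a \in I -> b \in I -> a - b \in I.
Proof. by move=> aI bI; rewrite prime_idealD ?prime_idealN. Qed.

Lemma prime_idealM a b : (a * b \in I) = (a \in I) || (b \in I).
Proof.
apply/idP/orP; first by case: pI => _ h /h/orP.
by case; [exact: prime_idealMl | exact: prime_idealMr].
Qed.

Lemma prime_idealX a n : a \notin I -> a ^+ n \notin I.
Proof.
move=> aI; elim: n => [|n IH]; first by rewrite expr0 prime_ideal1.
by rewrite exprS prime_idealM negb_or aI.
Qed.

Lemma prime_ideal_sum (J : Type) (s : seq J) (F : J -> R) :
  (forall j, F j \in I) -> \sum_(j <- s) F j \in I.
Proof. move=> h; apply: (big_ind (fun z => z \in I)) => //.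
  exact: prime_ideal0.
exact: prime_idealD. Qed.

End PrimeIdealTheory.

Section Graded.
Variables (R : idomainType) (G : nat -> {pred R}).
Hypothesis hG : grading G.
Implicit Types (a b c r : R) (m n i : nat).

Lemma graded0 n : 0 \in G n.
Proof. by case: (grading_zmod hG n). Qed.

Lemma gradedB n a b : a \in G n -> b \in G n -> a - b \in G n.
Proof. by case: (grading_zmod hG n) => _ /[apply] /[apply]. Qed.

Lemma gradedN n a : a \in G n -> - a \in G n.
Proof. by rewrite -sub0r; apply: gradedB; exact: graded0. Qed.

Lemma gradedD n a b : a \in G n -> b \in G n -> a + b \in G n.
Proof. by move=> aG bG; rewrite -[b]opprK gradedB // gradedN. Qed.

Lemma graded_sum n (J : Type) (s : seq J) (F : J -> R) :
  (forall j, F j \in G n) -> \sum_(j <- s) F j \in G n.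
Proof. move=> h; apply: (big_ind (fun z => z \in G n)) => //.
  exact: graded0.
exact: gradedD. Qed.

Definition gradedM := gradingM hG.

Lemma gradedX m n a : a \in G m -> a ^+ n \in G (n * m)%N.
Proof.
move=> aG; elim: n => [|n IH]; first by rewrite expr0 mul0n; exact: grading1.
by rewrite exprS mulSn gradedM.
Qed.

Lemma hcomp_subproof r :
  exists p : {poly R}, (forall i, p`_i \in G i) /\ p.[1] = r.
Proof.
have [N [c [cG ->]]] := grading_span hG r.
exists (\poly_(i < N) c i); split.
  by move=> i; rewrite coef_poly; case: ifP => // _; exact: graded0.
rewrite horner_poly big_mkord; apply: eq_bigr => i _.
by rewrite expr1n mulr1.
Qed.

(* The homogeneous components of r are the coefficients of [hcomp r]; this    *)
(* makes r |-> hcomp r the ring morphism R -> R[X] sending r in R_n to r X^n. *)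
Definition hcomp r : {poly R} := sval (cid (hcomp_subproof r)).

Lemma hcomp_in r i : (hcomp r)`_i \in G i.
Proof. by rewrite /hcomp; case: cid => p []. Qed.

Lemma horner_hcomp r : (hcomp r).[1] = r.
Proof. by rewrite /hcomp; case: cid => p []. Qed.

Lemma hcomp_sum r : r = \sum_(i < size (hcomp r)) (hcomp r)`_i.
Proof.
rewrite -{1}[r]horner_hcomp horner_coef; apply: eq_bigr => i _.
by rewrite expr1n mulr1.
Qed.

Lemma hcomp_uniq (p : {poly R}) r :
  (forall i, p`_i \in G i) -> p.[1] = r -> hcomp r = p.
Proof.
move=> pG pr; apply/eqP; rewrite -subr_eq0; apply/eqP.
set q := _ - p; have qG i : q`_i \in G i by rewrite coefB gradedB // hcomp_in.
have : q.[1] = 0 by rewrite !hornerE horner_hcomp pr subrr.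
rewrite horner_coef => q0; apply/polyP => i; rewrite coef0.
have [lt_i|le_i] := ltnP i (size q); last by rewrite nth_default.
apply: (grading_free hG (N := size q) qG) => //.
by rewrite big_mkord -[RHS]q0; apply: eq_bigr => j _; rewrite expr1n mulr1.
Qed.

Lemma hcompD a b : hcomp (a + b) = hcomp a + hcomp b.
Proof.
apply: hcomp_uniq => [i|]; last by rewrite hornerD !horner_hcomp.
by rewrite coefD gradedD // hcomp_in.
Qed.

Lemma hcompB a b : hcomp (a - b) = hcomp a - hcomp b.
Proof.
apply: hcomp_uniq => [i|]; last by rewrite hornerD hornerN !horner_hcomp.
by rewrite coefB gradedB // hcomp_in.
Qed.

Lemma hcompM a b : hcomp (a * b) = hcomp a * hcomp b.
Proof.
apply: hcomp_uniq => [i|]; last by rewrite hornerM !horner_hcomp.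
rewrite coefM; apply: graded_sum => j.
by rewrite -[X in G X](subnKC (ltn_ord j : j <= i)%N) gradedM // hcomp_in.
Qed.

Lemma hcomp_graded n a : a \in G n -> hcomp a = a *: 'X^n.
Proof.
move=> aG; apply: hcomp_uniq => [i|]; last first.
  by rewrite hornerZ hornerXn expr1n mulr1.
rewrite coefZ coefXn; have [->|_] := eqVneq; first by rewrite mulr1.
by rewrite mulr0 graded0.
Qed.

Lemma hcompE n a i : a \in G n -> (hcomp a)`_i = if i == n then a else 0.
Proof.
by move=> /hcomp_graded ->; rewrite coefZ coefXn; case: eqP; rewrite ?mulr1 ?mulr0.
Qed.

Lemma hcompMl n a r i : a \in G n ->
  (hcomp (a * r))`_i = if (i < n)%N then 0 else a * (hcomp r)`_(i - n).
Proof.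
move=> aG; rewrite hcompM (hcomp_graded aG) -scalerAl coefZ coefXnM.
by case: ifP; rewrite ?mulr0.
Qed.

(** Compare components of degree [n]: that of [b * c] is [b] times the component of [c] in degree
    [n - m], or zero if [n < m]. *)
Lemma graded_quotient m n a b c : a \in G n -> b \in G m -> a != 0 -> a = b * c ->
  exists2 c', c' \in G (n - m)%N & (m <= n)%N /\ a = b * c'.
Proof.
move=> aG bG a0 aE; exists (hcomp c)`_(n - m); first exact: hcomp_in.
have := hcompMl c n bG; rewrite -aE (hcompE n aG) eqxx.
by case: ltnP => // _ az; rewrite az eqxx in a0.
Qed.

Lemma hcomp0 : hcomp 0 = 0.
Proof. by rewrite (hcomp_graded (graded0 0)) scale0r. Qed.

Lemma hcomp_bigsum (J : Type) (s : seq J) (F : J -> R) :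
  hcomp (\sum_(j <- s) F j) = \sum_(j <- s) hcomp (F j).
Proof. exact: (big_morph hcomp hcompD hcomp0). Qed.

Lemma homogeneous_hcomp I r :
  homogeneous_ideal G I -> r \in I -> forall i, (hcomp r)`_i \in I.
Proof.
move=> hI rI i; have [lt_i|le_i] := ltnP i (size (hcomp r)).
  apply: (hI (size (hcomp r)) (fun i => (hcomp r)`_i)) => // [j|].
    exact: hcomp_in.
  by rewrite big_mkord -hcomp_sum.
(* Membership of 0 comes from homogeneity: the components of [r] are padded with one zero
   component. *)
rewrite nth_default //; apply: (hI 1%N (fun=> 0) _ _ 0%N) => // [j|].
  exact: graded0.
have := hI (size (hcomp r)).+1 (fun i => (hcomp r)`_i).
rewrite big_mkord big_ord_recr /= -hcomp_sum nth_default // addr0.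
move=> /(_ (hcomp_in r) rI (size (hcomp r)) (ltnSn _)).
by rewrite nth_default // big_nat1.
Qed.

Lemma hcomp_homogeneous (I : {pred R}) :
  (forall r, r \in I -> forall i, (hcomp r)`_i \in I) -> homogeneous_ideal G I.
Proof.
move=> hI N c cG /hI cI i ltiN; have := cI i.
rewrite big_mkord hcomp_bigsum coef_sum (bigD1 (Ordinal ltiN)) //=.
rewrite (hcompE _ (cG i)) eqxx big1 ?addr0 // => j /eqP ne_j.
rewrite (hcompE _ (cG j)); case: eqP => // ij; case: ne_j.
exact/val_inj.
Qed.

Lemma hcomp_prime I r : prime_ideal I ->
  (forall i, (hcomp r)`_i \in I) -> r \in I.
Proof. by move=> pI rI; rewrite (hcomp_sum r); exact: prime_ideal_sum. Qed.

Lemma subset_homogeneous (I J : {pred R}) :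
    homogeneous_ideal G I -> prime_ideal J ->
    (forall n a, a \in G n -> a \in I -> a \in J) ->
  {subset I <= J}.
Proof.
move=> hI pJ IJ r rI; apply: hcomp_prime => // i.
by apply: IJ (hcomp_in r i) _; exact: homogeneous_hcomp.
Qed.

(** * Homogeneous primes given by conditions on homogeneous elements *)

Section HomogeneousFamily.
Variable q : nat -> R -> Prop.
Hypotheses (q0 : forall n, q n 0)
  (qD : forall n a b, a \in G n -> b \in G n -> q n a -> q n b -> q n (a + b))
  (qM : forall m n a b, a \in G m -> b \in G n -> q n b -> q (m + n)%N (a * b))
  (q1 : ~ q 0%N 1)
  (qP : forall m n a b, a \in G m -> b \in G n -> q (m + n)%N (a * b) ->
        q m a \/ q n b).

Definition family_ideal : {pred R} :=
  set_pred [set r | forall i, q i (hcomp r)`_i].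

Lemma family_idealE n a : a \in G n -> a \in family_ideal <-> q n a.
Proof.
move=> aG; split.
  by move=> /set_predP/(_ n); rewrite (hcompE _ aG) eqxx.
by move=> qa; apply/set_predP => i; rewrite (hcompE _ aG); case: eqP => // ->.
Qed.

Let q_sum n (J : Type) (s : seq J) (P : pred J) (F : J -> R) :
  (forall j, P j -> F j \in G n /\ q n (F j)) ->
  q n (\sum_(j <- s | P j) F j).
Proof.
move=> FP; suff [] : (\sum_(j <- s | P j) F j) \in G n /\
  q n (\sum_(j <- s | P j) F j) by [].
apply: (big_ind (fun z => z \in G n /\ q n z)) => //; first by split; rewrite ?graded0.
by move=> x y [xG qx] [yG qy]; split; [exact: gradedD | exact: qD].
Qed.

Let qN n a : a \in G n -> q n a -> q n (- a).
Proof.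
move=> aG qa; rewrite -mulN1r -[n]add0n; apply: qM => //.
by rewrite gradedN // grading1.
Qed.

(** Let [i] and [j] be the lowest degrees in which [u] and [v] violate [q]. In degree [i + j] every
    term of [u * v] except [u_i * v_j] satisfies [q], so [u_i * v_j] does too, against [qP]. *)
Lemma family_ideal_prime : prime_ideal family_ideal.
Proof.
split; first split.
- by apply/set_predP => i; rewrite hcomp0 coef0.
- apply/negP => /set_predP/(_ 0%N).
  by rewrite (hcompE _ (grading1 hG)) eqxx.
- move=> a u v /set_predP qu /set_predP qv; apply/set_predP => i.
  rewrite hcompD hcompM coefD; apply: qD => //.
  + by rewrite -hcompM hcomp_in.
  + exact: hcomp_in.
  + rewrite coefM; apply: q_sum => j _.
    have E : (j + (i - j) = i)%N by rewrite subnKC // -ltnS ltn_ord.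
    rewrite -[X in G X]E -[X in q X]E; split; first by rewrite gradedM // hcomp_in.
    by apply: qM => //; exact: hcomp_in.
move=> u v /set_predP quv; apply/orP.
have [|/existsNP exi] := pselect (forall i, q i (hcomp u)`_i).
  by left; apply/set_predP.
have [|/existsNP exj] := pselect (forall i, q i (hcomp v)`_i).
  by right; apply/set_predP.
exfalso.
pose nu i := `[< ~ q i (hcomp u)`_i >]; pose nv i := `[< ~ q i (hcomp v)`_i >].
have exu : exists i, nu i by case: exi => i qi; exists i; apply/asboolP.
have exv : exists i, nv i by case: exj => i qi; exists i; apply/asboolP.
case: (ex_minnP exu) => i /asboolP qi imin; case: (ex_minnP exv) => j /asboolP qj jmin.
have lti l : (l < i)%N -> q l (hcomp u)`_l.
  move=> ltl; apply: contrapT => ql; have := imin l; rewrite leqNgt ltl.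
  by move=> /(_ (asboolT ql)).
have ltj l : (l < j)%N -> q l (hcomp v)`_l.
  move=> ltl; apply: contrapT => ql; have := jmin l; rewrite leqNgt ltl.
  by move=> /(_ (asboolT ql)).
have lei : (i < (i + j).+1)%N by rewrite ltnS leq_addr.
have Gl (l : 'I_(i + j).+1) : (hcomp u)`_l * (hcomp v)`_(i + j - l) \in G (i + j)%N.
  by rewrite -[X in G X](subnKC (ltn_ord l : l <= i + j)%N) gradedM // hcomp_in.
have : q (i + j)%N ((hcomp u)`_i * (hcomp v)`_j).
  have := quv (i + j)%N; rewrite hcompM coefM (bigD1 (Ordinal lei)) //= addKn.
  set z := \sum_(_ < _ | _) _ => qz.
  rewrite -[X in q _ X](addrK z); have zG : z \in G (i + j)%N.
    apply: (big_ind (fun z => z \in G (i + j)%N)) => // [|a b].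
      exact: graded0.
    exact: gradedD.
  apply: qD => //.
  - by rewrite gradedD // gradedM // hcomp_in.
  - exact: gradedN.
  apply: qN => //; apply: q_sum => l /eqP ne_l; split=> //.
  have E := subnKC (ltn_ord l : l <= i + j)%N.
  rewrite -[X in q X]E.
  have [ltli|leil] := ltnP l i.
    rewrite addnC mulrC; apply: qM; [exact: hcomp_in|exact: hcomp_in|exact: lti].
  apply: qM; [exact: hcomp_in|exact: hcomp_in|apply: ltj].
  have : (i != l)%N by apply/eqP => il; apply: ne_l; apply: val_inj.
  by move: (ltn_ord l); lia.
by case/qP; rewrite ?hcomp_in.
Qed.

Lemma family_ideal_homogeneous : homogeneous_ideal G family_ideal.
Proof.
apply: hcomp_homogeneous => r /set_predP qr i; apply/family_idealE => //.
exact: hcomp_in.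
Qed.

End HomogeneousFamily.

End Graded.

(** * Residue fields of closed points *)

Section ClosedPoints.
Variables (R : idomainType) (G : nat -> {pred R}).
Hypothesis hG : grading G.
Implicit Types P Q : proj_point G.

Lemma point_prime Q : prime_ideal Q. Proof. by case: (point_in_Proj Q). Qed.

Lemma point_homogeneous Q : homogeneous_ideal G Q.
Proof. by case: (point_in_Proj Q). Qed.

Arguments point_homogeneous Q : clear implicits.

Lemma pointP Q : exists n a, [/\ (0 < n)%N, a \in G n & a \notin Q].
Proof. by case: (point_in_Proj Q). Qed.

Lemma proj_point_eq P Q : {subset P <= Q} -> P = Q.
Proof.
move=> PQ; have QP := point_closed (point_in_Proj Q) PQ.
have : point_ideal P = point_ideal Q.
  by apply/funext => r; apply/idP/idP; [exact: PQ | exact: QP].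
case: P Q {PQ QP} => [I p1 p2] [J p3 p4] /= IJ; case: _ / IJ in p3 p4 *.
by congr ProjPoint; exact: Prop_irrelevance.
Qed.

(** Some homogeneous element of [P] is outside [Q]; a factor of positive degree outside [Q] makes
    its degree positive. *)
Lemma exists_separating P Q : P <> Q -> exists n a,
  [/\ (0 < n)%N, a \in G n, a \in P & a \notin Q].
Proof.
move=> PQ; apply: contrapT => none; apply: PQ; apply: proj_point_eq.
apply: (subset_homogeneous hG (point_homogeneous P) (point_prime Q)) => n a aG aP.
apply/negPn/negP => aQ; have [m [b [m0 bG bQ]]] := pointP Q.
apply: none; exists (n + m)%N, (a * b); split; first by rewrite addn_gt0 m0 orbT.
- exact: gradedM.
- by rewrite (prime_idealMl (point_prime P)).
- by rewrite (prime_idealM (point_prime Q)) negb_or aQ.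
Qed.

(** The ideal [Q + aR]. *)
Definition point_plus Q a : set R := [set z | exists r, z - a * r \in Q].

Lemma point_plus_ideal Q a : ideal (point_plus Q a).
Proof.
have pQ := point_prime Q; split.
- by exists 0; rewrite mulr0 subr0 prime_ideal0.
- move=> b c [r rb] [r' rc]; exists (r + r').
  by rewrite mulrDr opprD addrACA prime_idealD.
- move=> b c [r rc]; exists (b * r); rewrite mulrCA -mulrBr.
  exact: prime_idealMr.
Qed.

(* The homogeneous Nullstellensatz for R/Q, whose only homogeneous prime      *)
(* containing a is the irrelevant one because Q is closed.                    *)
Lemma closed_point_radical Q n a m y : a \in G n -> a \notin Q ->
  (0 < m)%N -> y \in G m -> exists j r, y ^+ j - a * r \in Q.
Proof.
move=> aG aQ m0 yG; apply: contrapT => none; have pQ := point_prime Q.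
have [|j [r yI]|I' [pI II' yI']] :=
  @prime_ideal_avoiding _ (point_plus Q a) y.
- exact: point_plus_ideal.
- by apply: none; exists j, r.
(* The homogeneous elements of [I'] generate a homogeneous prime [H] that contains [Q] and [a] but
   not [y]. As [Q] is closed, [H] equals [Q], so [a] would lie in [Q]. *)
pose q (i : nat) r : Prop := r \in I'.
have q0 n0 : q n0 0 by exact: prime_ideal0.
have qD (n0 : nat) b c : b \in G n0 -> c \in G n0 -> q n0 b -> q n0 c -> q n0 (b + c).
  by move=> _ _; exact: prime_idealD.
have qM m0' n0 b c : b \in G m0' -> c \in G n0 -> q n0 c -> q (m0' + n0)%N (b * c).
  by move=> _ _; exact: prime_idealMr.
have q1 : ~ q 0%N 1 by apply/negP; exact: prime_ideal1.
have qP m0' n0 b c : b \in G m0' -> c \in G n0 -> q (m0' + n0)%N (b * c) ->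
    q m0' b \/ q n0 c.
  by move=> _ _; rewrite /q prime_idealM // => /orP.
pose H := family_ideal hG q.
have HE i r : r \in G i -> r \in H <-> r \in I' by exact: family_idealE.
have HP : in_Proj G H.
  split; [exact: family_ideal_prime | exact: family_ideal_homogeneous |].
  by exists m, y; split=> //; apply: contraNN yI' => /(HE _ _ yG).
have QH : {subset Q <= H}.
  apply: (subset_homogeneous hG (point_homogeneous Q)).
    exact: family_ideal_prime.
  move=> i b bG bQ; apply/(HE _ _ bG)/II'.
  by exists 0; rewrite mulr0 subr0.
move: aQ; rewrite (point_closed HP QH) //; apply/(HE _ _ aG)/II'.
by exists 1; rewrite mulr1 subrr prime_ideal0.
Qed.

End ClosedPoints.

Arguments point_homogeneous {R G} Q.

Section ResidueField.
Variables (k : closedFieldType) (R : idomainType) (iota : {rmorphism k -> R}).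
Variable (G : nat -> {pred R}).
Hypotheses (hG : grading G)
  (hG0 : forall r : R, r \in G 0%N <-> exists c : k, r = iota c)
  (hfg : fin_gen_algebra iota).
Implicit Types P Q : proj_point G.

Lemma iota_graded c : iota c \in G 0%N.
Proof. by apply/hG0; exists c. Qed.

Lemma gradedZ n c a : a \in G n -> iota c * a \in G n.
Proof. by move=> aG; rewrite -[n]add0n gradedM // iota_graded. Qed.

Lemma iota_notin (I : {pred R}) c : prime_ideal I -> c != 0 -> iota c \notin I.
Proof.
move=> pI c0; apply: contra (prime_ideal1 pI) => cI.
by rewrite -(rmorph1 iota) -(mulVf c0) rmorphM prime_idealMr.
Qed.

Lemma graded0_notin (I : {pred R}) a : prime_ideal I -> a \in G 0%N -> a != 0 ->
  a \notin I.
Proof.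
move=> pI /hG0[c ->] c0; apply: iota_notin => //.
by apply: contraNneq c0 => ->; rewrite rmorph0.
Qed.

(** Take the components of positive degree of the given generators, each paired with its degree;
    components of degree 0 are constants. *)
Lemma homogeneous_generators : exists ys : seq (nat * R),
  (forall y, y \in ys -> (0 < y.1)%N /\ y.2 \in G y.1) /\
  forall A : {pred R}, subring_closed A -> (forall c, iota c \in A) ->
    (forall y, y \in ys -> y.2 \in A) -> forall r, r \in A.
Proof.
have [gs gsP] := hfg.
exists [seq (i, (hcomp hG g)`_i) | g <- gs, i <- seq.iota 1 (size (hcomp hG g))].
split.
  move=> _ /allpairsPdep[g [i [_ + ->]]]; rewrite mem_iota => /andP[i0 _].
  by split=> //; exact: hcomp_in.
move=> A sA cA yA; apply: gsP => // g gin; have [A1 AB _] := sA.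
have AD u v : u \in A -> v \in A -> u + v \in A.
  move=> uA vA; rewrite -[v]opprK; apply: (AB) => //; rewrite -sub0r; apply: (AB) => //.
  by rewrite -(subrr 1) AB.
rewrite (hcomp_sum hG g); apply: (big_ind (fun z => z \in A)) => //.
  by rewrite -(subrr 1) AB.
case=> -[|i] lti _ /=.
  by have /hG0[c ->] := hcomp_in hG g 0.
apply: (yA (i.+1, _)); apply/allpairsPdep; exists g, i.+1; split=> //.
by rewrite mem_iota add1n /= ltnS ltnW.
Qed.

Fixpoint monomials (J : nat) (ys : seq (nat * R)) : seq (nat * R) :=
  if ys is y :: ys' then
    [seq ((i * y.1 + w.1)%N, y.2 ^+ i * w.2) | i <- seq.iota 0 J, w <- monomials J ys']
  else [:: (0%N, 1)].

Lemma monomials_graded J ys : (forall y, y \in ys -> y.2 \in G y.1) ->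
  forall w, w \in monomials J ys -> w.2 \in G w.1.
Proof.
elim: ys => [|y ys IH] ysG w /=.
  by rewrite inE => /eqP -> /=; exact: grading1.
move=> /allpairsP[[i v] /= [_ vin ->]] /=.
apply: gradedM => //; first by apply: gradedX => //; apply: ysG; rewrite mem_head.
by apply: IH vin => z zin; apply: ysG; rewrite inE zin orbT.
Qed.

Lemma monomials1 J ys : (0 < J)%N -> exists2 w, w \in monomials J ys & w.2 = 1.
Proof.
move=> J0; elim: ys => [|y ys [w win w1]] /=.
  by exists (0%N, 1); rewrite ?mem_head.
exists ((0 * y.1 + w.1)%N, y.2 ^+ 0 * w.2); last by rewrite /= expr0 mul1r.
by apply/allpairsP; exists (0%N, w); split; rewrite ?mem_iota.
Qed.

Lemma monomials_generator J ys y : (1 < J)%N -> y \in ys ->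
  exists2 w, w \in monomials J ys & w.2 = y.2.
Proof.
move=> J1; elim: ys => [//|z ys IH]; rewrite inE => /orP[/eqP <-|yin] /=.
  have [w win w1] := monomials1 ys (ltnW J1).
  exists ((1 * y.1 + w.1)%N, y.2 ^+ 1 * w.2); last by rewrite /= expr1 w1 mulr1.
  by apply/allpairsP; exists (1%N, w); split; rewrite ?mem_iota.
have [w win wy] := IH yin.
exists ((0 * z.1 + w.1)%N, z.2 ^+ 0 * w.2); last by rewrite /= expr0 mul1r.
by apply/allpairsP; exists (0%N, w); split; rewrite ?mem_iota //= (ltnW J1).
Qed.

(** Exponents add: either all stay below [J], or some factor [y ^+ J] puts the product in [I]. *)
Lemma monomialsM J ys (I : set R) : ideal I ->
  (forall y, y \in ys -> I (y.2 ^+ J)) ->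
  forall v w, v \in monomials J ys -> w \in monomials J ys ->
  (exists2 z, z \in monomials J ys & v.2 * w.2 = z.2) \/ I (v.2 * w.2).
Proof.
move=> iI; elim: ys => [|y ys IH] yI v w /=.
  rewrite !inE => /eqP -> /eqP ->; left.
  by exists (0%N, 1); rewrite ?mem_head //= mulr1.
move=> /allpairsP[[i v'] /= [iJ vin ->]] /allpairsP[[j w'] /= [jJ win ->]] /=.
have -> : y.2 ^+ i * v'.2 * (y.2 ^+ j * w'.2) = y.2 ^+ (i + j) * (v'.2 * w'.2).
  by rewrite exprD mulrACA.
have [leJ|ltJ] := leqP J (i + j).
  right; rewrite -(subnK leJ) exprD -mulrA; apply: idealM => //.
  rewrite mulrC; apply: idealM => //; apply: yI; exact: mem_head.
have [|[z zin ->]|Ivw] := IH _ v' w' vin win; last first.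
- by right; apply: idealM.
- left; exists (((i + j) * y.1 + z.1)%N, y.2 ^+ (i + j) * z.2) => //.
  by apply/allpairsP; exists ((i + j)%N, z); split; rewrite ?mem_iota.
- by move=> z zin; apply: yI; rewrite inE zin orbT.
Qed.

(** The ring [R / (Q + aR)] is finite dimensional: by [closed_point_radical] every homogeneous
    generator is nilpotent in it, so the monomials with bounded exponents span. *)
Lemma point_plus_finite Q n a : a \in G n -> a \notin Q ->
  exists C (w : 'I_C -> nat * R), (forall i, (w i).2 \in G (w i).1) /\
    forall r, exists c, point_plus Q a (r - lincomb iota c (fun i => (w i).2)).
Proof.
move=> aG aQ; have [ys [ysG ysA]] := homogeneous_generators.
have iI := point_plus_ideal Q a; set I := point_plus Q a in iI *.
have [J J1 yI] : exists2 J, (1 < J)%N & forall y, y \in ys -> I (y.2 ^+ J).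
  elim: ys {ysA} ysG => [|y ys IH] ysG; first by exists 2%N.
  have [|J J1 JI] := IH; first by move=> z zin; apply: ysG; rewrite inE zin orbT.
  have [y0 yG] := ysG _ (mem_head _ _).
  have [j [r yj]] := closed_point_radical hG aG aQ y0 yG.
  exists (J + j)%N; first by rewrite ltn_addr.
  move=> z; rewrite inE exprD => /orP[/eqP ->|/JI Iz]; last first.
    by rewrite mulrC; apply: idealM.
  by apply: idealM => //; exists r.
pose W := monomials J ys.
exists (size W), (fun i => nth (0%N, 1) W i); split.
  by move=> i; apply: (@monomials_graded J ys); [by move=> y /ysG[]|exact: mem_nth].
set e := fun i : 'I_ _ => _.
(* It suffices that the span of the monomials modulo [I] is a subring containing the constants and
   the generators. *)
pose A := [set r | exists c, I (r - lincomb iota c e)].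
suff AT : forall r, r \in set_pred A by move=> r; exact: set_predP (AT r).
have A0 : A 0.
  exists (fun=> 0); rewrite /lincomb big1 ?subr0; first exact: ideal0.
  by move=> i _; rewrite rmorph0 mul0r.
have AD u v : A u -> A v -> A (u + v).
  move=> [c Ic] [c' Ic']; exists (fun i => c i + c' i).
  by rewrite lincombD opprD addrACA; apply: idealD.
have AZ c u : A u -> A (iota c * u).
  move=> [c' Ic]; exists (fun i => c * c' i).
  by rewrite lincombZ -mulrBr; apply: idealM.
have sA : subspace iota A by [].
have IA u : I u -> A u.
  move=> Iu; exists (fun=> 0); rewrite /lincomb big1 ?subr0 //.
  by move=> i _; rewrite rmorph0 mul0r.
have eA i : A (e i).
  exists (fun j => (j == i)%:R); rewrite /lincomb (bigD1 i) //= eqxx rmorph1 mul1r.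
  rewrite big1 ?addr0 ?subrr; first exact: ideal0.
  by move=> j /negPf ->; rewrite rmorph0 mul0r.
have WA w : w \in W -> A w.2.
  move=> win; have lt_w : (index w W < size W)%N by rewrite index_mem.
  by have := eA (Ordinal lt_w); rewrite /e /= nth_index.
have A1 : A 1 by have [w /WA] := monomials1 ys (ltnW J1); move=> + <-.
apply: ysA; last 2 first.
- by move=> c; apply/set_predP; rewrite -[iota c]mulr1; exact: AZ.
- move=> y /(monomials_generator J1)[w /WA Aw <-]; exact/set_predP.
split; first exact/set_predP.
  move=> u v /set_predP Au /set_predP Av; apply/set_predP; exact: (subspaceB sA).
move=> u v /set_predP[c Ic] /set_predP[c' Ic']; apply/set_predP.
set p := lincomb _ _ _ in Ic; set p' := lincomb _ _ _ in Ic'.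
(* Modulo [I] the product is [p * p'], which expands into products of two monomials. *)
have -> : u * v = v * (u - p) + (p * (v - p') + p * p').
  by rewrite -mulrDr subrK mulrBr [v * p]mulrC subrK mulrC.
apply: (AD); first by apply: IA; apply: idealM.
apply: (AD); first by apply: IA; apply: idealM.
rewrite mulr_suml; apply: (subspace_sum sA) => i.
rewrite -mulrA mulr_sumr; apply: (AZ); apply: (subspace_sum sA) => j.
rewrite mulrCA; apply: AZ.
have inW (l : 'I_(size W)) : nth (0%N, 1) W l \in W by exact: mem_nth.
have [[z zW E]|] := monomialsM iI yI (inW i) (inW j); last exact: IA.
by rewrite /e E; exact: WA.
Qed.

(** The dimension of [(R/Q)_m] is bounded independently of [m]. Modulo [Q], an element of degree [m]
    is a combination of the [w i] of degree [m] plus [a] times an element of degree [m - n], so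
    induction on [m] applies. *)
Lemma point_graded_span Q n a : a \in G n -> a \notin Q -> (0 < n)%N ->
  exists C, forall m, exists e : 'I_C -> R,
    forall r, r \in G m -> exists c, r - lincomb iota c e \in Q.
Proof.
move=> aG aQ n0; have [C [w [wG wspan]]] := point_plus_finite aG aQ.
have pQ := point_prime Q; have hQ := point_homogeneous Q.
exists C => m; suff [e _ eP] : exists2 e : 'I_C -> R,
    forall i, (m < (w i).1)%N -> e i = 0 &
    forall r, r \in G m -> exists c, r - lincomb iota c e \in Q by exists e.
elim/ltn_ind: m => m IH.
pose e0 i := if (w i).1 == m then (w i).2 else 0.
have wE i c : (hcomp hG (iota c * (w i).2))`_m = iota c * e0 i.
  rewrite (hcompE hG m (gradedZ c (wG i))) /e0 eq_sym.
  by case: eqP; rewrite ?mulr0.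
have comp r : r \in G m -> exists c b,
    r - lincomb iota c e0 - (if (m < n)%N then 0 else a * b) \in Q /\
    b \in G (m - n)%N.
  move=> rG; have [c [b]] := wspan r.
  move=> /(homogeneous_hcomp hG hQ)/(_ m); rewrite !hcompB !coefB.
  rewrite (hcompE hG m rG) eqxx (hcompMl hG _ _ aG) hcomp_bigsum coef_sum.
  under eq_bigr do rewrite wE.
  by move=> E; exists c, (hcomp hG b)`_(m - n); split; last exact: hcomp_in.
have [ltmn|lenm] := ltnP m n.
  exists e0 => [i ltm|r /comp[c [b []]]]; first by rewrite /e0 gtn_eqF.
  by rewrite ltmn subr0 => rQ _; exists c.
have [|e e_gt eP] := IH (m - n)%N; first by rewrite ltn_subrL n0 (leq_trans n0).
exists (fun i => if (w i).1 == m then (w i).2 else a * e i).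
  by move=> i ltm; rewrite gtn_eqF // e_gt ?mulr0 // (leq_ltn_trans (leq_subr _ _) ltm).
move=> r /comp[c [b [rQ /eP[c' bQ]]]].
exists (fun i => if (w i).1 == m then c i else c' i).
have -> : lincomb iota (fun i => if (w i).1 == m then c i else c' i)
    (fun i => if (w i).1 == m then (w i).2 else a * e i) =
    lincomb iota c e0 + a * lincomb iota c' e.
  rewrite /lincomb mulr_sumr -big_split; apply: eq_bigr => i _ /=.
  rewrite /e0; case: eqP => [E|_]; last by rewrite mulr0 add0r mulrCA.
  by rewrite e_gt ?mulr0 ?addr0 // E ltn_subrL n0 (leq_trans n0).
move: rQ; rewrite ltnNge lenm /= => rQ.
have -> : r - (lincomb iota c e0 + a * lincomb iota c' e) =
    r - lincomb iota c e0 - a * b + a * (b - lincomb iota c' e).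
  by rewrite mulrBr addrA subrK opprD addrA.
by rewrite prime_idealD // prime_idealMr.
Qed.

(** The homogenization [b^N p(a/b)], where [N] may exceed the degree of [p]. *)
Definition hompoly (p : {poly k}) N (a b : R) : R :=
  \sum_(i < N.+1) iota p`_i * (a ^+ i * b ^+ (N - i)).

Lemma hompoly_factor (p : {poly k}) N z a b : (size p <= N.+1)%N ->
  hompoly (p * ('X - z%:P)) N.+1 a b = (a - iota z * b) * hompoly p N a b.
Proof.
move=> szp; rewrite mulrBl; under [LHS]eq_bigr do
  rewrite mulrBr coefB coefMC rmorphB rmorphM mulrBl.
rewrite sumrB; congr (_ - _).
  rewrite big_ord_recl coefMX eqxx rmorph0 mul0r add0r mulr_sumr.
  by apply: eq_bigr => i _; rewrite coefMX /= subSS exprS -mulrA mulrCA.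
rewrite big_ord_recr /= nth_default // rmorph0 !mul0r addr0 mulr_sumr.
apply: eq_bigr => i _; rewrite subSn ?exprS; last by rewrite -ltnS.
rewrite [iota _ * iota z]mulrC -!mulrA; congr (_ * _).
by rewrite [RHS]mulrCA; congr (_ * _); rewrite mulrCA.
Qed.

(** Over the algebraically closed [k] the form splits into a constant, powers of [b] and factors
    [a - z b]; primality puts one of the latter in [I]. *)
Lemma hompoly_root (I : {pred R}) (p : {poly k}) N a b : prime_ideal I ->
  b \notin I -> p != 0 -> (size p <= N.+1)%N -> hompoly p N a b \in I ->
  exists z, a - iota z * b \in I.
Proof.
move=> pI bI; elim: N p => [|N IH] p p0 szp.
  rewrite /hompoly big_ord1 expr0 mul1r expr0 mulr1 => pIn.
  have : lead_coef p != 0 by rewrite lead_coef_eq0.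
  rewrite lead_coefE; have -> : (size p).-1 = 0%N.
    by move: szp; case: (size p) => [|[]].
  by move=> /(iota_notin pI); rewrite pIn.
have [sz1|] := eqVneq (size p) 1%N.
  have /size_poly1P[c c0 ->] : size p == 1%N by rewrite sz1.
  rewrite /hompoly big_ord_recl big1 ?addr0 => [|i _]; last first.
    by rewrite coefC /= rmorph0 mul0r.
  rewrite coefC /= expr0 mul1r (prime_idealM pI) (negPf (iota_notin pI c0)) /=.
  by rewrite (negPf (prime_idealX pI _ bI)).
move=> /closed_rootP[z /factor_theorem[p' Ep]].
have p'0 : p' != 0 by apply: contraNneq p0 => p'0; rewrite Ep p'0 mul0r.
have szp' : (size p' <= N.+1)%N.
  by move: szp; rewrite Ep size_Mmonic ?monicXsubC // size_XsubC addn2.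
rewrite Ep hompoly_factor // (prime_idealM pI) => /orP[]; first by exists z.
exact: IH.
Qed.

(* The residue field of the closed point Q is k.                              *)
Lemma point_residue Q n a b : a \in G n -> b \in G n -> b \notin Q ->
  exists z, a - iota z * b \in Q.
Proof.
move=> aG bG bQ; have pQ := point_prime Q.
have [n0|n0] := posnP n.
  move: aG bG bQ; rewrite n0 => /hG0[c ->] /hG0[c' ->] bQ.
  exists (c / c'); rewrite -rmorphM divfK ?subrr ?prime_ideal0 //.
  by apply: contraNneq bQ => ->; rewrite rmorph0 prime_ideal0.
have [aQ|aQ] := boolP (a \in Q).
  by exists 0; rewrite rmorph0 mul0r subr0.
(* The [C + 1] monomials of degree [C] in [a] and [b] are dependent modulo [Q], because [C] vectors
   span [R/Q] in degree [C * n]. *)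
have [C /(_ (C * n)%N)[e eP]] := point_graded_span bG bQ n0.
have sQ : subspace iota [set r | r \in Q].
  split; first exact: prime_ideal0.
    by move=> *; exact: prime_idealD.
  by move=> *; exact: prime_idealMr.
pose v (i : 'I_C.+1) := a ^+ i * b ^+ (C - i).
have [j|u [j uj0] uQ] := dependent_mod (e := e) (v := v) sQ _ (ltnSn C).
  apply: eP; rewrite -{1}(subnKC (ltn_ord j : j <= C)%N) mulnDl.
  by apply: gradedM => //; exact: gradedX.
pose p := \poly_(i < C.+1) u (inord i).
apply: (@hompoly_root _ p C) => //.
- apply: contraNneq uj0 => p0; have := coef_poly C.+1 (fun i => u (inord i)) j.
  by rewrite -/p p0 coef0 ltn_ord inord_val => <-.
- exact: size_poly.
- rewrite /hompoly; under eq_bigr => i _ do rewrite coef_poly ltn_ord inord_val.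
  exact: uQ.
Qed.

End ResidueField.

(** * Valuations at closed points *)

Lemma mulf_swap (F : fieldType) (x y z w : F) : z != 0 ->
  x * y / w = z * y / w * (x / z).
Proof. by move=> z0; rewrite [RHS]mulrC -!mulrA mulKf. Qed.

Section LocalRings.
Variables (R : idomainType) (G : nat -> {pred R}).
Hypothesis hG : grading G.
Implicit Types (P Q : proj_point G) (f g h t u : {fraction R}).

Lemma notin_neq0 (I : {pred R}) b : prime_ideal I -> b \notin I -> b != 0.
Proof. by move=> pI; apply: contraNneq => ->; exact: prime_ideal0. Qed.

Lemma notin_frac0 Q b : b \notin Q -> b%:F != 0.
Proof. by move=> bQ; rewrite tofrac_eq0 (notin_neq0 (point_prime Q)). Qed.

Lemma local_frac Q n a b : a \in G n -> b \in G n -> b \notin Q ->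
  local_ring Q (a%:F / b%:F).
Proof. by exists n, a, b. Qed.

Lemma max_frac Q n a b : a \in G n -> b \in G n -> b \notin Q -> a \in Q ->
  local_max Q (a%:F / b%:F).
Proof. by exists n, a, b. Qed.

Lemma max_local Q f : local_max Q f -> local_ring Q f.
Proof. by move=> [n [a [b [aG aQ bG bQ ->]]]]; exact: local_frac aG bG bQ. Qed.

Lemma localM Q f g : local_ring Q f -> local_ring Q g -> local_ring Q (f * g).
Proof.
move=> [n [a [b [aG bG bQ ->]]]] [m [c [d [cG dG dQ ->]]]].
rewrite mulf_div -!tofracM; apply: (@local_frac Q (n + m)); rewrite ?gradedM //.
by rewrite (prime_idealM (point_prime Q)) negb_or bQ.
Qed.

Lemma local_maxM Q f g : local_ring Q f -> local_max Q g -> local_max Q (f * g).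
Proof.
move=> [n [a [b [aG bG bQ ->]]]] [m [c [d [cG cQ dG dQ ->]]]].
rewrite mulf_div -!tofracM; apply: (@max_frac Q (n + m)); rewrite ?gradedM //.
  by rewrite (prime_idealM (point_prime Q)) negb_or bQ.
by rewrite (prime_idealMr (point_prime Q)).
Qed.

Lemma localD Q f g : local_ring Q f -> local_ring Q g -> local_ring Q (f + g).
Proof.
move=> [n [a [b [aG bG bQ ->]]]] [m [c [d [cG dG dQ ->]]]].
rewrite addf_div ?(notin_frac0 (Q := Q)) // -!tofracM -tofracD.
apply: (@local_frac Q (n + m)); last 1 first.
- by rewrite (prime_idealM (point_prime Q)) negb_or bQ.
- by apply: gradedD => //; [|rewrite mulrC]; exact: gradedM.
- exact: gradedM.
Qed.

Lemma local0 Q : local_ring Q 0.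
Proof.
exists 0%N, 0, 1; rewrite graded0 // grading1 // (prime_ideal1 (point_prime Q)).
by rewrite tofrac0 mul0r.
Qed.

Lemma local1 Q : local_ring Q 1.
Proof.
exists 0%N, 1, 1; rewrite grading1 // (prime_ideal1 (point_prime Q)).
by rewrite tofrac1 divr1.
Qed.

Lemma max_fracE Q n a b : a \in G n -> b \in G n -> b \notin Q ->
  local_max Q (a%:F / b%:F) -> a \in Q.
Proof.
move=> aG bG bQ [m [c [d [cG cQ dG dQ /eqP]]]]; have pQ := point_prime Q.
rewrite eqr_div ?(notin_frac0 (Q := Q)) // -!tofracM tofrac_eq => /eqP E.
have := prime_idealMl pQ b cQ; rewrite -E (prime_idealM pQ) (negPf dQ) orbF.
by [].
Qed.

Lemma local_max1 Q : ~ local_max Q 1.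
Proof.
have G1 := grading1 hG; have Q1 := prime_ideal1 (point_prime Q).
rewrite -[1](divr1) -tofrac1 => /(max_fracE G1 G1 Q1).
by rewrite (negPf Q1).
Qed.

Definition local_unit Q u := [/\ u != 0, local_ring Q u & local_ring Q u^-1].

Lemma local_unit_frac Q n a b : a \in G n -> b \in G n -> a \notin Q ->
  b \notin Q -> local_unit Q (a%:F / b%:F).
Proof.
move=> aG bG aQ bQ; split; last by rewrite invf_div; exact: local_frac bG aG aQ.
  by rewrite mulf_neq0 ?invr_eq0 // (notin_frac0 (Q := Q)).
exact: local_frac aG bG bQ.
Qed.

Lemma local_cases Q f : local_ring Q f -> local_max Q f \/ local_unit Q f.
Proof.
move=> [n [a [b [aG bG bQ ->]]]]; have [aQ|aQ] := boolP (a \in Q).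
  by left; exact: max_frac aG bG bQ aQ.
by right; exact: local_unit_frac aG bG aQ bQ.
Qed.

Lemma local_unit_max Q f : local_unit Q f -> ~ local_max Q f.
Proof.
move=> [f0 _ fV] /(local_maxM fV); rewrite mulVf //; exact: local_max1.
Qed.

Lemma local_unit1 Q : local_unit Q 1.
Proof. by split; rewrite ?oner_neq0 ?invr1 //; exact: local1. Qed.

Lemma local_unitM Q f g : local_unit Q f -> local_unit Q g -> local_unit Q (f * g).
Proof.
move=> [f0 fO fV] [g0 gO gV]; split; first by rewrite mulf_neq0.
  exact: localM.
by rewrite invfM; exact: localM.
Qed.

Lemma local_unitV Q f : local_unit Q f -> local_unit Q f^-1.
Proof. by move=> [f0 fO fV]; split; rewrite ?invrK ?invr_eq0. Qed.

Lemma local_unitX Q f (n : int) : local_unit Q f -> local_unit Q (f ^ n).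
Proof.
move=> uf; have h m : local_unit Q (f ^+ m).
  elim: m => [|m IH]; first by rewrite expr0; exact: local_unit1.
  by rewrite exprS; exact: local_unitM.
by case: n => m; [exact: h | rewrite NegzE -exprnN; exact/local_unitV/h].
Qed.

Lemma localX Q f n : local_ring Q f -> local_ring Q (f ^+ n).
Proof.
move=> fO; elim: n => [|n IH]; first by rewrite expr0; exact: local1.
by rewrite exprS; exact: localM.
Qed.

Lemma uniformizer_max Q t : uniformizer Q t -> local_max Q t.
Proof. by move=> ->; exists 1; [exact: local1 | rewrite mulr1]. Qed.

Lemma uniformizer_div Q t f : uniformizer Q t -> local_max Q f ->
  exists2 h, local_ring Q h & f = t * h.
Proof. by move=> -> [h hO <-]; exists h. Qed.

(** The element 0 counts as a uniformizer when the maximal ideal is zero, hence the condition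
    [t != 0]. *)
Definition good_point Q := exists2 t, uniformizer Q t & t != 0.

(** Otherwise a unit would equal a positive power of [t], which lies in the maximal ideal. *)
Lemma is_ord_uniq Q t u v (n m : int) : uniformizer Q t -> t != 0 ->
  local_unit Q u -> local_unit Q v -> u * t ^ n = v * t ^ m -> n = m.
Proof.
move=> ut t0; wlog ltnm : n m u v / (n < m)%R.
  move=> W uu uv E; case: (ltgtP n m) => // nm.
    exact: (W n m u v).
  by apply/esym; exact: (W m n v u).
move=> uu uv E; exfalso.
have [l El] : exists l : nat, m = n + l.+1.
  exists (`|m - n|.-1)%N; lia.
have [v0 _ _] := uv.
have : u / v = t ^+ l.+1.
  apply: (mulIf (expfz_neq0 n t0)); rewrite mulrAC E El expfzDr // exprnP.
  by rewrite mulrAC mulfV // mul1r mulrC.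
move=> E'; apply: (local_unit_max (local_unitM uu (local_unitV uv))).
rewrite E' exprSr; apply: local_maxM (uniformizer_max ut).
exact/localX/max_local/uniformizer_max.
Qed.

(** Two uniformizers differ by a unit, so the order may be computed with a fixed one. *)
Lemma is_ordP Q t g (n : int) : uniformizer Q t -> t != 0 ->
  is_ord Q g n <-> exists2 u, local_unit Q u & g = u * t ^ n.
Proof.
move=> ut t0; split=> [[t' [u [ut' u0 uO uV ->]]]|[u [u0 uO uV] ->]]; last first.
  by exists t, u.
have [w wO tE] := uniformizer_div ut (uniformizer_max ut').
have [w' wO' tE'] := uniformizer_div ut' (uniformizer_max ut).
have ww' : w * w' = 1.
  by apply: (mulfI t0); rewrite mulrA -tE mulr1 -tE'.
have w0 : w != 0 by apply: contra_eq_neq ww' => ->; rewrite mul0r eq_sym oner_neq0.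
have uw : local_unit Q w.
  by split=> //; rewrite -[w^-1]mul1r -ww' mulrAC mulfV // mul1r.
exists (u * w ^ n); first by apply: local_unitM; [split|exact: local_unitX].
by rewrite tE expfzMl mulrA mulrAC.
Qed.

Lemma ord_eq Q t u g (n : int) : uniformizer Q t -> t != 0 -> local_unit Q u ->
  g = u * t ^ n -> ord Q g = n.
Proof.
move=> ut t0 uu gE; have gn : is_ord Q g n by apply/(is_ordP _ _ ut t0); exists u.
rewrite /ord; case: xgetP => [m _ /(is_ordP _ _ ut t0)[v uv]|/(_ n)//].
by rewrite gE => E; apply/esym/(is_ord_uniq ut t0 uu uv E).
Qed.

(** A uniformizer at such a point is 0, and [u * 0 ^ n] is nonzero only for [n = 0]; if no order
    exists, [xget] returns its default 0. *)
Lemma ord_bad Q g : ~ good_point Q -> g != 0 -> ord Q g = 0.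
Proof.
move=> bad g0; rewrite /ord; case: xgetP => // n _ [t [u [ut u0 _ _ gE]]].
have t0 : t = 0 by apply: contrapT => /eqP t0; apply: bad; exists t.
by move: g0; rewrite gE t0 exp0rz; have [->|_] := eqVneq n 0; rewrite ?mulr0 ?eqxx.
Qed.

Lemma ff_frac n a b : a \in G n -> b \in G n -> b != 0 ->
  function_field G (a%:F / b%:F).
Proof. by exists n, a, b. Qed.

Lemma ffM f g : function_field G f -> function_field G g -> function_field G (f * g).
Proof.
move=> [n [a [b [aG bG b0 ->]]]] [m [c [d [cG dG d0 ->]]]].
rewrite mulf_div -!tofracM; apply: (@ff_frac (n + m)); rewrite ?gradedM //.
exact: mulf_neq0.
Qed.

Lemma ffV f : function_field G f -> function_field G f^-1.
Proof.
move=> [n [a [b [aG bG b0 ->]]]]; rewrite invf_div.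
have [->|a0] := eqVneq a 0.
  rewrite tofrac0 invr0 mulr0; exists 0%N, 0, 1.
  by rewrite graded0 // grading1 // oner_neq0 tofrac0 mul0r.
exact: (@ff_frac n).
Qed.

Lemma local_ff Q f : local_ring Q f -> function_field G f.
Proof.
by move=> [n [a [b [aG bG bQ ->]]]]; apply: ff_frac aG bG (notin_neq0 (point_prime Q) bQ).
Qed.

Lemma ff_local_quotient Q f : function_field G f -> exists g h,
  [/\ local_ring Q g, local_ring Q h, h != 0 & f = g / h].
Proof.
move=> [n [a [b [aG bG b0 ->]]]]; have [[|e] [w [// _ wG wQ]]] := pointP Q.
have wnG : w ^+ n \in G (e.+1 * n)%N by rewrite mulnC; exact: gradedX.
have wnQ := prime_idealX (point_prime Q) n wQ.
have bF : b%:F != 0 by rewrite tofrac_eq0.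
have wF := notin_frac0 wnQ.
(* The factor [b ^+ e] raises both degrees to [e.+1 * n], the degree of [w ^+ n], which is
   invertible at [Q]. *)
exists ((a * b ^+ e)%:F / (w ^+ n)%:F), ((b ^+ e.+1)%:F / (w ^+ n)%:F); split.
- by apply: local_frac _ wnG wnQ; rewrite mulSn gradedM // gradedX.
- by apply: local_frac _ wnG wnQ; exact: gradedX.
- by rewrite mulf_neq0 ?invr_eq0 // tofrac_eq0 expf_neq0.
- rewrite invf_div mulf_div [_ * (w ^+ n)%:F]mulrC -mulf_div mulfV // mul1r.
  by rewrite exprS !tofracM -mulf_div mulfV ?mulr1 // tofrac_eq0 expf_neq0.
Qed.

End LocalRings.

(** * Chains of primes in dimension two *)

Section ChainOfThree.
Variables (k : closedFieldType) (R : idomainType) (iota : {rmorphism k -> R}).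
Variable (G : nat -> {pred R}).
Hypotheses (hG : grading G)
  (hG0 : forall r : R, r \in G 0%N <-> exists c : k, r = iota c)
  (hdim : krull_dim R 2).

Definition irrelevant_ideal : {pred R} := set_pred [set r | (hcomp hG r)`_0 = 0].

Lemma irrelevant_prime : prime_ideal irrelevant_ideal.
Proof.
split; first split.
- by apply/set_predP; rewrite /= hcomp0 coef0.
- apply/negP => /set_predP /=; rewrite (hcompE hG _ (grading1 hG)) eqxx.
  by move/eqP; rewrite oner_eq0.
- move=> a u v /set_predP /= u0 /set_predP /= v0; apply/set_predP => /=.
  by rewrite hcompD hcompM coefD coef0M u0 v0 mulr0 addr0.
move=> u v /set_predP /= /eqP; rewrite hcompM coef0M mulf_eq0.
by case/orP => /eqP h; apply/orP; [left|right]; apply/set_predP.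
Qed.

Lemma zero_prime : prime_ideal (pred1 (0 : R)).
Proof.
split; first split; rewrite ?inE ?eqxx ?oner_eq0 //.
  by move=> a u v; rewrite !inE => /eqP -> /eqP ->; rewrite mulr0 addr0.
by move=> u v; rewrite !inE mulf_eq0.
Qed.

Lemma in_Proj_irrelevant I : in_Proj G I -> {subset I <= irrelevant_ideal}.
Proof.
move=> [pI hI _] r rI; apply/set_predP => /=; apply: contrapT => /eqP r0.
have := homogeneous_hcomp hG hI rI 0.
by rewrite (negPf (graded0_notin hG0 pI (hcomp_in _ _ _) r0)).
Qed.

(* Otherwise 0, I, J and the irrelevant ideal would form a chain of length 3. *)
Lemma prime_below_Proj (I J : {pred R}) (a : R) : prime_ideal I -> a != 0 -> a \in I ->
  in_Proj G J -> {subset I <= J} -> {subset J <= I}.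
Proof.
move=> pI a0 aI JP IJ; apply: contrapT => JI; have [_ []] := hdim.
exists (fun i : nat => match i return {pred R} with
  0%N => pred1 0 | 1%N => I | 2%N => J | _ => irrelevant_ideal end).
split.
  move=> [|[|[|i]]] _ //; [exact: zero_prime | by case: JP | exact: irrelevant_prime].
move=> [|[|[|i]]] // _.
- split=> [r|I0]; first by rewrite inE => /eqP ->; exact: prime_ideal0.
  by have := I0 _ aI; rewrite inE (negPf a0).
- split; first exact: in_Proj_irrelevant.
  case: JP => _ _ [n [b [n0 bG bJ]]] irrJ; case/negP: bJ; apply: irrJ.
  by apply/set_predP; rewrite /= (hcompE hG _ bG) ltn_eqF.
Qed.

End ChainOfThree.

(** * The discrete valuation at a good point *)

Section Valuation.
Variables (k : closedFieldType) (R : idomainType) (iota : {rmorphism k -> R}).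
Variable (G : nat -> {pred R}).
Hypotheses (hG : grading G)
  (hG0 : forall r : R, r \in G 0%N <-> exists c : k, r = iota c)
  (hdim : krull_dim R 2).
Implicit Types (P Q : proj_point G) (f g h t u : {fraction R}).

Section InfinitelyDivisible.
Variables (Q : proj_point G) (t : {fraction R}).
Hypotheses (ut : uniformizer Q t) (t0 : t != 0).

(** The intersection of the powers of the maximal ideal; the local ring is a discrete valuation ring
    once this is zero. *)
Definition inf_div f := forall n, exists2 h, local_ring Q h & f = t ^+ n * h.

Lemma inf_div_or_ord f : local_ring Q f ->
  inf_div f \/ exists n u, local_unit Q u /\ f = u * t ^+ n.
Proof.
move=> fO; have [|none] := pselect (exists n u, local_unit Q u /\ f = u * t ^+ n).
  by right.
left; elim=> [|n [h hO fE]]; first by exists f; rewrite // expr0 mul1r.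
have [/(uniformizer_div ut)[h' hO' hE]|uh] := local_cases hO.
  by exists h' => //; rewrite fE hE exprSr mulrA.
by case: none; exists n, h; rewrite mulrC.
Qed.

Lemma inf_divD f g : inf_div f -> inf_div g -> inf_div (f + g).
Proof.
move=> If Ig n; have [h hO ->] := If n; have [h' hO' ->] := Ig n.
by exists (h + h'); [exact: localD | rewrite mulrDr].
Qed.

Lemma inf_divM f g : local_ring Q f -> inf_div g -> inf_div (f * g).
Proof.
move=> fO Ig n; have [h hO ->] := Ig n.
by exists (f * h); [exact: localM | rewrite mulrCA].
Qed.

Lemma inf_div0 : inf_div 0.
Proof. by move=> n; exists 0; [exact: local0 | rewrite mulr0]. Qed.

Lemma inf_div_unit u n : local_unit Q u -> ~ inf_div (u * t ^+ n).
Proof.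
move=> uu /(_ n.+1)[h hO]; rewrite mulrC exprSr -mulrA.
move=> /(mulfI (expf_neq0 n t0)) uE; apply: (local_unit_max hG uu).
by rewrite uE mulrC; apply: local_maxM => //; exact: uniformizer_max.
Qed.

Lemma inf_div_prime f g : local_ring Q f -> local_ring Q g ->
  inf_div (f * g) -> inf_div f \/ inf_div g.
Proof.
move=> /inf_div_or_ord[|[n [u [uu ->]]]]; first by left.
move=> /inf_div_or_ord[|[m [v [uv ->]]]]; first by right.
by rewrite mulrACA -exprD => /inf_div_unit; case; exact: local_unitM.
Qed.

(* An infinitely divisible a/b would put a in a homogeneous prime strictly    *)
(* between 0 and Q.                                                           *)
Lemma inf_div_eq0 f : local_ring Q f -> inf_div f -> f = 0.
Proof.
move=> [n0 [a0 [b0 [a0G b0G b0Q ->]]]] If.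
have pQ := point_prime Q; have [e [w [e0 wG wQ]]] := pointP Q.
have wX j : w ^+ j \in G (j * e)%N by exact: gradedX.
have wXQ j : w ^+ j \notin Q by exact: prime_idealX.
(* Infinite divisibility of a homogeneous [r] at [Q]: a multiple [r * c] whose degree is divisible
   by [e] is turned into a function by dividing by a power of [w]. *)
pose q (m : nat) (r : R) := forall l c j, c \in G l -> (m + l = j * e)%N ->
  inf_div ((r * c)%:F / (w ^+ j)%:F).
have qO m (r : R) l c j : r \in G m -> c \in G l -> (m + l = j * e)%N ->
    local_ring Q ((r * c)%:F / (w ^+ j)%:F).
  by move=> rG cG E; apply: local_frac _ (wX j) (wXQ j); rewrite -E gradedM.
have q0 n : q n 0.
  by move=> l c j _ _; rewrite mul0r tofrac0 mul0r; exact: inf_div0.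
have qD n a b : a \in G n -> b \in G n -> q n a -> q n b -> q n (a + b).
  move=> aG bG qa qb l c j cG E; rewrite mulrDl tofracD mulrDl.
  by apply: inf_divD; [exact: qa cG E | exact: qb cG E].
have qM m n a b : a \in G m -> b \in G n -> q n b -> q (m + n)%N (a * b).
  move=> aG bG qb l c j cG E; rewrite [a * b]mulrC -mulrA.
  by apply: (qb (m + l)%N); [exact: gradedM | rewrite -E; lia].
have q1 : ~ q 0%N 1.
  move=> /(_ 0%N 1 0%N (grading1 hG) erefl).
  rewrite mulr1 expr0 tofrac1 divr1 -[1]mulr1 -[X in _ * X](expr0 t).
  by apply: inf_div_unit; exact: local_unit1.
have qP m n a b : a \in G m -> b \in G n -> q (m + n)%N (a * b) -> q m a \/ q n b.
  move=> aG bG qab; apply: contrapT => /not_orP[].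
  move=> /existsNP[l /existsNP[c /existsNP[j /not_implyP[cG /not_implyP[E na]]]]].
  move=> /existsNP[l' /existsNP[c' /existsNP[j' /not_implyP[cG' /not_implyP[E' nb]]]]].
  have [|//|//] := inf_div_prime (qO _ _ _ _ _ aG cG E) (qO _ _ _ _ _ bG cG' E').
  rewrite mulf_div -!tofracM mulrACA -exprD; apply: (qab (l + l')%N).
    exact: gradedM.
  by rewrite addnACA E E' mulnDl.
pose H := family_ideal hG q.
have HE n r : r \in G n -> r \in H <-> q n r by exact: family_idealE.
have pH : prime_ideal H by exact: family_ideal_prime.
have HQ : {subset H <= Q}.
  apply: (subset_homogeneous hG) => // [|n a aG /(HE _ _ aG) qa].
    exact: family_ideal_homogeneous.
  apply: contrapT => /negP aQ.
  have : inf_div ((a ^+ e)%:F / (w ^+ n)%:F).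
    rewrite -(prednK e0) exprS; apply: (qa (e.-1 * n)%N); first exact: gradedX.
    by rewrite -mulSn prednK // mulnC.
  rewrite -[X in inf_div X]mulr1 -[X in _ * X](expr0 t); apply: inf_div_unit.
  apply: (@local_unit_frac _ _ Q (n * e)) => //; last exact: prime_idealX.
  by rewrite mulnC; exact: gradedX.
have a0H : a0 \in H.
  apply/(HE _ _ a0G) => l c j cG E.
  have -> : (a0 * c)%:F / (w ^+ j)%:F =
      ((b0 * c)%:F / (w ^+ j)%:F) * (a0%:F / b0%:F).
    by rewrite !tofracM (mulf_swap _ _ _ (notin_frac0 b0Q)).
  by apply: inf_divM => //; exact: qO b0G cG E.
have [->|a00] := eqVneq a0 0; first by rewrite tofrac0 mul0r.
have [n [a [b [aG aQ bG bQ tE]]]] := uniformizer_max hG ut.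
(* If [a0] is nonzero, [H] is a nonzero prime inside [Q], hence all of [Q]. It then contains the
   numerator of [t], so a unit times [t] would be infinitely divisible. *)
have /(HE _ _ aG) qa := prime_below_Proj hG hG0 hdim pH a00 a0H (point_in_Proj Q) HQ aQ.
have : inf_div ((b ^+ e)%:F / (w ^+ n)%:F * t ^+ 1).
  have -> : (b ^+ e)%:F / (w ^+ n)%:F * t ^+ 1 = (a * b ^+ e.-1)%:F / (w ^+ n)%:F.
    by rewrite expr1 tE -{1}(prednK e0) exprS !tofracM -(mulf_swap _ _ _ (notin_frac0 bQ)).
  apply: (qa (e.-1 * n)%N); first exact: gradedX.
  by rewrite -mulSn prednK // mulnC.
move=> /inf_div_unit; case; apply: (@local_unit_frac _ _ Q (n * e)) => //.
  by rewrite mulnC; exact: gradedX.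
exact: prime_idealX.
Qed.

End InfinitelyDivisible.

Lemma local_ord Q t f : uniformizer Q t -> t != 0 -> local_ring Q f -> f != 0 ->
  exists n u, local_unit Q u /\ f = u * t ^+ n.
Proof.
move=> ut t0 fO f0; case: (inf_div_or_ord ut fO) => // /(inf_div_eq0 ut t0 fO) fz.
by rewrite fz eqxx in f0.
Qed.

Lemma ordE Q t g : uniformizer Q t -> t != 0 -> function_field G g -> g != 0 ->
  exists2 u, local_unit Q u & g = u * t ^ (ord Q g).
Proof.
move=> ut t0 Kg g0; have [a [b [aO bO b0 gE]]] := ff_local_quotient hG Q Kg.
have a0 : a != 0 by apply: contraNneq g0 => az; rewrite gE az mul0r.
have [n [u [uu aE]]] := local_ord ut t0 aO a0; have [m [v [uv bE]]] := local_ord ut t0 bO b0.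
have gE' : g = u / v * t ^ (n%:Z - m%:Z).
  by rewrite gE aE bE invfM mulrACA expfzDr // -exprnN.
have uuv := local_unitM hG uu (local_unitV uv).
by rewrite (ord_eq hG ut t0 uuv gE'); exists (u / v).
Qed.

Lemma ordM Q f g : function_field G f -> function_field G g ->
  f != 0 -> g != 0 -> ord Q (f * g) = ord Q f + ord Q g.
Proof.
move=> Kf Kg f0 g0; have [[t ut t0]|bad] := pselect (good_point Q); last first.
  by rewrite !ord_bad ?mulf_neq0.
have [u uu fE] := ordE ut t0 Kf f0; have [v uv gE] := ordE ut t0 Kg g0.
apply: (ord_eq hG ut t0 (local_unitM hG uu uv)).
by rewrite {1}fE {1}gE mulrACA expfzDr.
Qed.

Lemma ord_unit Q u : local_unit Q u -> ord Q u = 0.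
Proof.
move=> uu; have [[t ut t0]|bad] := pselect (good_point Q); last first.
  by case: uu => u0 _ _; rewrite ord_bad.
by apply: (ord_eq hG ut t0 uu); rewrite expr0z mulr1.
Qed.

Lemma ordV Q f : function_field G f -> f != 0 -> ord Q f^-1 = - ord Q f.
Proof.
move=> Kf f0; have f'0 : f^-1 != 0 by rewrite invr_eq0.
have := ordM Q Kf (ffV hG Kf) f0 f'0.
rewrite mulfV // (ord_unit (local_unit1 hG Q)) => /esym/eqP.
by rewrite addrC addr_eq0 => /eqP.
Qed.

Lemma ord_local Q f : good_point Q -> function_field G f -> f != 0 ->
  0 <= ord Q f -> local_ring Q f.
Proof.
move=> [t ut t0] Kf f0; have [u [_ uO _] fE] := ordE ut t0 Kf f0.
case E : (ord Q f) => [n|//] _; rewrite fE E; apply: localM => //.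
exact/localX/max_local/uniformizer_max.
Qed.

Lemma ord_ge0 Q f : local_ring Q f -> f != 0 -> 0 <= ord Q f.
Proof.
move=> fO f0; have [[t ut t0]|bad] := pselect (good_point Q); last first.
  by rewrite ord_bad.
have [n [u [uu fE]]] := local_ord ut t0 fO f0.
by rewrite (ord_eq hG ut t0 (n := n%:Z) uu).
Qed.

Lemma ord_gt0 Q f : good_point Q -> local_max Q f -> f != 0 -> 0 < ord Q f.
Proof.
move=> [t ut t0] fM f0; have [h hO fE] := uniformizer_div ut fM.
have h0 : h != 0 by apply: contraNneq f0 => hz; rewrite fE hz mulr0.
have [n [u [uu hE]]] := local_ord ut t0 hO h0.
rewrite (ord_eq hG ut t0 (n := n.+1%:Z) uu) //.
by rewrite fE hE mulrCA -exprnP exprS.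
Qed.

Lemma ordD Q f g : function_field G f -> function_field G g ->
  f != 0 -> f + g != 0 -> local_ring Q (g / f) -> ord Q f <= ord Q (f + g).
Proof.
move=> Kf Kg f0 fg0 gfO.
have E : f + g = f * (1 + g / f) by rewrite mulrDr mulr1 mulrCA mulfV // mulr1.
have h0 : 1 + g / f != 0 by apply: contraNneq fg0 => hz; rewrite E hz mulr0.
have hO : local_ring Q (1 + g / f) by apply: localD => //; exact: local1.
by rewrite E ordM //; [rewrite lerDl ord_ge0 | exact: local_ff hO].
Qed.

End Valuation.

(** * Orders of vanishing of sections *)

Section SectionOrder.
Variables (k : closedFieldType) (R : idomainType) (iota : {rmorphism k -> R}).
Variable (G : nat -> {pred R}).
Hypotheses (hG : grading G)
  (hG0 : forall r : R, r \in G 0%N <-> exists c : k, r = iota c)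
  (hdim : krull_dim R 2).
Variables (T : {fraction R}) (D : proj_point G -> rat).
Hypotheses (hT : homog_frac G 1 T) (hT0 : T != 0)
  (hDample : ample D) (hRD : section_ring D T).
Implicit Types (P Q : proj_point G) (f g r : R).

(* Order of vanishing at Q of r in R_n, seen as a section of nD.              *)
Definition sec_ord Q (n : nat) r : rat :=
  (ord Q (r%:F / T ^+ n))%:~R + n%:R * D Q.

Lemma sec_ff n r : r \in G n -> function_field G (r%:F / T ^+ n).
Proof.
move=> rG; have [m [a [b [aG bG b0 TE]]]] := hT.
have a0 : a != 0.
  by apply: contraNneq hT0 => a0; rewrite TE a0 tofrac0 mul0r.
rewrite TE expr_div_n invf_div mulrA -!tofracXn -tofracM.
apply: (@ff_frac _ _ (n * (1 + m))); last exact: expf_neq0.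
  by rewrite mulnDr muln1; apply: gradedM => //; exact: gradedX.
exact: gradedX.
Qed.

Lemma sec_neq0 n r : r != 0 -> r%:F / T ^+ n != 0.
Proof. by move=> r0; rewrite mulf_neq0 ?tofrac_eq0 ?invr_eq0 ?expf_neq0. Qed.

Lemma sec_ordM Q n m r g : r \in G n -> g \in G m -> r != 0 -> g != 0 ->
  sec_ord Q (n + m) (r * g) = sec_ord Q n r + sec_ord Q m g.
Proof.
move=> rG gG r0 g0; rewrite /sec_ord tofracM exprD -mulf_div.
rewrite (ordM hG hG0 hdim Q (sec_ff rG) (sec_ff gG) (sec_neq0 n r0) (sec_neq0 m g0)).
by rewrite rmorphD natrD mulrDl addrACA.
Qed.

Lemma sec_ord1 Q : sec_ord Q 0 1 = 0.
Proof.
rewrite /sec_ord expr0 tofrac1 divr1 mul0r addr0.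
by rewrite (ord_unit hG (local_unit1 hG Q)).
Qed.

Lemma sec_ordX Q n j r : r \in G n -> r != 0 ->
  sec_ord Q (j * n) (r ^+ j) = j%:R * sec_ord Q n r.
Proof.
move=> rG r0; elim: j => [|j IH]; first by rewrite expr0 sec_ord1 mul0r.
rewrite exprS mulSn sec_ordM ?expf_neq0 ?IH //; last exact: gradedX.
by rewrite -[in RHS]natr1 mulrDl mul1r addrC.
Qed.

Lemma sec_ord_ge0 Q n r : r \in G n -> r != 0 -> 0 <= sec_ord Q n r.
Proof.
move=> rG r0; have [g [_ Hg] rE] : exists2 g, H0 (scale_div n D) g & r%:F = g * T ^+ n.
  by apply/hRD; exists r.
have gE : r%:F / T ^+ n = g by rewrite rE mulfK // expf_neq0.
case: Hg => [g0|/(_ Q)]; last by rewrite -gE.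
by have := sec_neq0 n r0; rewrite gE g0 eqxx.
Qed.

Lemma ord_frac Q n r g : r \in G n -> g \in G n -> r != 0 -> g != 0 ->
  (ord Q (r%:F / g%:F))%:~R = sec_ord Q n r - sec_ord Q n g.
Proof.
move=> rG gG r0 g0; have -> : r%:F / g%:F = r%:F / T ^+ n * (g%:F / T ^+ n)^-1.
  by rewrite invf_div mulrA mulfVK // expf_neq0.
have gV0 : (g%:F / T ^+ n)^-1 != 0 by rewrite invr_eq0 sec_neq0.
rewrite (ordM hG hG0 hdim Q (sec_ff rG) (ffV hG (sec_ff gG)) (sec_neq0 n r0) gV0).
rewrite (ordV hG hG0 hdim Q (sec_ff gG) (sec_neq0 n g0)).
by rewrite /sec_ord rmorphD rmorphN opprD addrACA subrr addr0.
Qed.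

(** As a section of [(n - m) D], the quotient [r / f] has an effective divisor, so the section ring
    contains it. *)
Lemma sec_ord_div n m r f : r \in G n -> f \in G m -> f != 0 -> (m <= n)%N ->
  (r != 0 -> forall Q, sec_ord Q m f <= sec_ord Q n r) ->
  exists2 h, h \in G (n - m)%N & r = f * h.
Proof.
move=> rG fG f0 lemn le_fr.
have fF : f%:F != 0 by rewrite tofrac_eq0.
have TX j : T ^+ j != 0 by rewrite expf_neq0.
pose g := r%:F / T ^+ n / (f%:F / T ^+ m).
have gE : g * T ^+ (n - m) = r%:F / f%:F.
  rewrite /g invf_div mulf_div mulrAC -[r%:F * _ * _]mulrA -exprD subnKC //.
  by rewrite [r%:F * _]mulrC -mulf_div mulfV // mul1r.
have [|h hGr hE] := (hRD (n - m)%N (g * T ^+ (n - m))).2.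
  exists g => //; split; first by apply: ffM (sec_ff rG) (ffV hG (sec_ff fG)).
  have [rz|r0] := eqVneq r 0; first by left; rewrite /g rz tofrac0 !mul0r.
  have fV0 : (f%:F / T ^+ m)^-1 != 0 by rewrite invr_eq0 sec_neq0.
  right => Q; rewrite /principal_div.
  rewrite (ordM hG hG0 hdim Q (sec_ff rG) (ffV hG (sec_ff fG)) (sec_neq0 n r0) fV0).
  rewrite (ordV hG hG0 hdim Q (sec_ff fG) (sec_neq0 m f0)).
  have := le_fr r0 Q; rewrite /sec_ord /scale_div rmorphD rmorphN natrB //=.
  lra.
exists h => //; apply/eqP; rewrite -tofrac_eq tofracM -hE gE mulrC mulfVK //.
Qed.

Lemma ample_witness Q : exists M f,
  [/\ (0 < M)%N, f \in G M, f != 0 & sec_ord Q M f = 0].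
Proof.
have [N N0 [_ Nample]] := hDample; have [n [a [n0 aG aQ]]] := pointP Q.
have [m [g [m0 Hg [g0 gQ] _]]] := Nample n a Q n0 aG aQ.
have DE : scale_div m (scale_div N D) = scale_div (m * N) D.
  by apply/funext => P; rewrite /scale_div natrM mulrA.
rewrite DE in Hg gQ.
have [|f fG fE] := (hRD (m * N)%N (g * T ^+ (m * N))).2; first by exists g.
have gE : f%:F / T ^+ (m * N) = g by rewrite -fE mulfK // expf_neq0.
exists (m * N)%N, f; split=> //; first by rewrite muln_gt0 m0.
  by rewrite -tofrac_eq0 -fE mulf_neq0 // expf_neq0.
by rewrite /sec_ord gE.
Qed.

(** All orders of functions are 0 there, so the section [f] of degree [M] not vanishing at [Q] gives
    [M * D Q = 0]. *)
Lemma sec_ord_bad Q n r : ~ good_point Q -> r != 0 -> sec_ord Q n r = 0.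
Proof.
move=> bad r0; have [M [f [M0 fG f0]]] := ample_witness Q.
rewrite /sec_ord !ord_bad ?sec_neq0 // !add0r => /eqP.
by rewrite mulf_eq0 pnatr_eq0 eqn0Ngt M0 /= => /eqP ->; rewrite mulr0.
Qed.

(** With [f] of degree [M] and order 0 at [Q], the function [f ^+ n / r ^+ M] is regular at [Q], so
    [M] times the order of [r] is at most 0. *)
Lemma sec_ord_notin Q n r : r \in G n -> r \notin Q -> sec_ord Q n r = 0.
Proof.
move=> rG rQ; have r0 := notin_neq0 (point_prime Q) rQ.
have [M [f [M0 fG f0 fQ]]] := ample_witness Q.
have rMG : r ^+ M \in G (n * M)%N by rewrite mulnC; exact: gradedX.
have fnG : f ^+ n \in G (n * M)%N by exact: gradedX.
have rMQ := prime_idealX (point_prime Q) M rQ.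
have fO : 0 <= ord Q ((f ^+ n)%:F / (r ^+ M)%:F).
  apply: (ord_ge0 hG hG0 hdim); first exact: local_frac fnG rMG rMQ.
  by rewrite mulf_neq0 ?invr_eq0 ?tofrac_eq0 ?expf_neq0.
have : 0 <= (ord Q ((f ^+ n)%:F / (r ^+ M)%:F))%:~R :> rat by rewrite ler0z.
rewrite (ord_frac Q fnG rMG) ?expf_neq0 // sec_ordX // fQ mulr0 sub0r oppr_ge0.
rewrite [X in sec_ord _ X]mulnC sec_ordX // pmulr_rle0 ?ltr0n // => rle.
by apply/eqP; rewrite eq_le rle sec_ord_ge0.
Qed.

(** With [w] of degree [e] outside [Q], the function [r ^+ e / w ^+ n] lies in the maximal ideal and
    has [e] times the order of [r]. *)
Lemma sec_ord_in Q n r : good_point Q -> r \in G n -> r \in Q -> r != 0 ->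
  0 < sec_ord Q n r.
Proof.
move=> gQ rG rQ r0; have [e [w [e0 wG wQ]]] := pointP Q.
have w0 := notin_neq0 (point_prime Q) wQ.
have reG : r ^+ e \in G (e * n)%N by exact: gradedX.
have wnG : w ^+ n \in G (e * n)%N by rewrite mulnC; exact: gradedX.
have wnQ := prime_idealX (point_prime Q) n wQ.
have : 0 < ord Q ((r ^+ e)%:F / (w ^+ n)%:F).
  apply: (ord_gt0 hG hG0 hdim) => //.
    apply: max_frac reG wnG wnQ _.
    by rewrite -(prednK e0) exprS (prime_idealMl (point_prime Q)).
  by rewrite mulf_neq0 ?invr_eq0 ?tofrac_eq0 ?expf_neq0.
rewrite -(ltr0z rat) (ord_frac Q reG wnG) ?expf_neq0 // (sec_ord_notin wnG wnQ) subr0.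
by rewrite sec_ordX // pmulr_rgt0 // ltr0n.
Qed.

Lemma sec_ord_gt0 Q n r : r \in G n -> r != 0 -> 0 < sec_ord Q n r ->
  good_point Q /\ r \in Q.
Proof.
move=> rG r0 rQ; split; apply: contrapT.
  by move=> /sec_ord_bad bad; rewrite bad // in rQ.
by move=> /negP /(sec_ord_notin rG) E; rewrite E in rQ.
Qed.

(** Zero is treated apart because [ord] carries no meaning there. *)
Definition vanishing Q n (m : rat) r : Prop := r = 0 \/ m <= sec_ord Q n r.

Lemma vanishingD Q n m r g : r \in G n -> g \in G n ->
  vanishing Q n m r -> vanishing Q n m g -> vanishing Q n m (r + g).
Proof.
move=> rG gG [->|mr]; first by rewrite add0r.
case=> [->|mg]; first by rewrite addr0; right.
have [->|r0] := eqVneq r 0; first by rewrite add0r; right.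
have [->|g0] := eqVneq g 0; first by rewrite addr0; right.
have [->|rg0] := eqVneq (r + g) 0; [by left|right].
have [gQ|bad] := pselect (good_point Q); last first.
  by rewrite sec_ord_bad // -(sec_ord_bad n bad r0).
wlog le_rg : r g rG gG mr mg r0 g0 rg0 / sec_ord Q n r <= sec_ord Q n g.
  move=> W; have [|/ltW] := leP (sec_ord Q n r) (sec_ord Q n g); first exact: W.
  by rewrite addrC; apply: W => //; rewrite addrC.
have rF : r%:F / T ^+ n != 0 by exact: sec_neq0.
have : ord Q (r%:F / T ^+ n) <= ord Q (r%:F / T ^+ n + g%:F / T ^+ n).
  apply: (ordD hG hG0 hdim) => //; [exact: sec_ff|exact: sec_ff| |].
    by rewrite -mulrDl -tofracD sec_neq0.
  have -> : g%:F / T ^+ n / (r%:F / T ^+ n) = g%:F / r%:F.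
    by rewrite invf_div mulrA mulfVK // expf_neq0.
  apply: (ord_local hG hG0 hdim gQ); first exact: ff_frac gG rG r0.
    by rewrite mulf_neq0 ?invr_eq0 ?tofrac_eq0.
  by rewrite -(ler0z rat) (ord_frac Q gG rG) // subr_ge0.
rewrite -mulrDl -tofracD -(ler_int rat) => le_ord.
by apply: (le_trans mr); rewrite /sec_ord lerD2r.
Qed.

Lemma sec_ord_const Q c : c != 0 -> sec_ord Q 0 (iota c) = 0.
Proof.
move=> c0; apply: sec_ord_notin; first by apply/hG0; exists c.
exact: iota_notin (point_prime Q) c0.
Qed.

Lemma vanishingZ Q n m c r : r \in G n -> vanishing Q n m r ->
  vanishing Q n m (iota c * r).
Proof.
move=> rG [->|mr]; first by left; rewrite mulr0.
have [->|c0] := eqVneq c 0; first by left; rewrite rmorph0 mul0r.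
have [->|r0] := eqVneq r 0; first by left; rewrite mulr0.
right; rewrite -[n]add0n sec_ordM //; first by rewrite sec_ord_const // add0r.
  by apply/hG0; exists c.
by rewrite fmorph_eq0.
Qed.

End SectionOrder.

(** * Points cut out by one homogeneous element *)

Lemma ratz_succ (n : nat) (z : int) :
  n%:R < z%:~R :> rat -> n.+1%:R <= z%:~R :> rat.
Proof.
rewrite -[n%:R]/((n%:Z)%:~R) -[n.+1%:R]/((n.+1%:Z)%:~R) ltr_int ler_int; lia.
Qed.

Lemma subn_mul_split (s d i n : nat) : (s <= i)%N -> (i * d <= n)%N ->
  (n - s * d = (i - s) * d + (n - i * d))%N.
Proof.
by move=> les; have : (s * d <= i * d)%N; [rewrite leq_mul2r les orbT|rewrite mulnBl; lia].
Qed.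

Lemma uniformizer_identity (A : comNzRingType) (u v p c b q : A) :
  u * v * p * (c * (b * q)) = u * b * (v * p * c) * q.
Proof.
rewrite -!mulrA; congr (_ * _).
by rewrite [RHS]mulrCA [b * (p * _)]mulrCA [b * (c * _)]mulrCA.
Qed.

Section PrincipalPoint.
Variables (k : closedFieldType) (R : idomainType) (iota : {rmorphism k -> R}).
Variable (G : nat -> {pred R}).
Hypotheses (hG : grading G)
  (hG0 : forall r : R, r \in G 0%N <-> exists c : k, r = iota c)
  (hfg : fin_gen_algebra iota)
  (hdim : krull_dim R 2).
Variables (T : {fraction R}) (D : proj_point G -> rat).
Hypotheses (hT : homog_frac G 1 T) (hT0 : T != 0)
  (hDample : ample D) (hRD : section_ring D T).
Variables (d : nat) (x : R) (P : proj_point G).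
Hypotheses (hd : (0 < d)%N) (xG : x \in G d) (x0 : x != 0)
  (hPx : forall a, a \in P <-> exists c, a = c * x).
Implicit Types (Q : proj_point G) (a b c r f v : R).

Let pP := point_prime P.
Local Notation sec := (sec_ord T D).
Local Notation s := (ngcd (quot_degrees G P)).

Let sec_ge0 Q n a : a \in G n -> a != 0 -> 0 <= sec Q n a.
Proof. exact: (sec_ord_ge0 hT0 hRD). Qed.

Let sec_notin Q n a : a \in G n -> a \notin Q -> sec Q n a = 0.
Proof. exact: (sec_ord_notin hG hG0 hdim hT hT0 hDample hRD). Qed.

Let secM Q n m a b : a \in G n -> b \in G m -> a != 0 -> b != 0 ->
  sec Q (n + m) (a * b) = sec Q n a + sec Q m b.
Proof. exact: (sec_ordM hG hG0 hdim D hT hT0). Qed.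

Let secX Q n j a : a \in G n -> a != 0 -> sec Q (j * n) (a ^+ j) = j%:R * sec Q n a.
Proof. exact: (sec_ordX hG hG0 hdim D hT hT0). Qed.

Let sec_frac Q n a b : a \in G n -> b \in G n -> a != 0 -> b != 0 ->
  (ord Q (a%:F / b%:F))%:~R = sec Q n a - sec Q n b.
Proof. exact: (ord_frac hG hG0 hdim D hT hT0). Qed.

Lemma generator_in : x \in P. Proof. by apply/hPx; exists 1; rewrite mul1r. Qed.

Lemma principal_div_graded n a : a \in G n -> a \in P -> a != 0 ->
  exists2 c, c \in G (n - d)%N & (d <= n)%N /\ a = x * c.
Proof.
by move=> aG /hPx[c aE] a0; apply: (graded_quotient hG aG xG a0 (c := c)); rewrite mulrC.
Qed.

Lemma generator_factor n a : a \in G n -> a != 0 -> exists i a',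
  [/\ (i * d <= n)%N, a' \in G (n - i * d)%N, a' \notin P & a = x ^+ i * a'].
Proof.
elim/ltn_ind: n a => n IH a aG a0; have [aP|aP] := boolP (a \in P); last first.
  by exists 0%N, a; rewrite mul0n subn0 expr0 mul1r.
have [c cG [led aE]] := principal_div_graded aG aP a0.
have c0 : c != 0 by apply: contraNneq a0 => c0; rewrite aE c0 mulr0.
have [|i [c' [lei c'G c'P cE]]] := IH (n - d)%N _ c cG c0.
  by rewrite ltn_subrL hd (leq_trans hd).
exists i.+1, c'; rewrite mulSn -leq_subRL // subnDA; split=> //.
by rewrite aE cE exprS mulrA.
Qed.

Lemma degree_dvd n a : a \in G n -> a \notin P -> (s %| n)%N.
Proof. by move=> aG aP; apply: ngcd_dvd; exists a. Qed.

Lemma ngcd_degrees_gt0 : (0 < s)%N.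
Proof. by have [n [a [n0 aG aP]]] := pointP P; apply: ngcd_gt0 n0; exists a. Qed.

Lemma degrees_large : exists M, forall m, (M <= m)%N -> (s %| m)%N ->
  exists2 a, a \in G m & a \notin P.
Proof.
apply: (ngcd_semigroup (S := quot_degrees G P)) ngcd_degrees_gt0.
  by exists 1; [exact: grading1 | exact: prime_ideal1].
move=> m n [a aG aP] [b bG bP]; exists (a * b); first exact: gradedM.
by rewrite (prime_idealM pP) negb_or aP.
Qed.

(** By [generator_factor] the gcd of [d] and [s] divides the degree of every nonzero homogeneous
    element; numerator and denominator of [T] have consecutive degrees. *)
Lemma coprime_degrees : coprime d s.
Proof.
have [n [a [b [aG bG b0 TE]]]] := hT.
have a0 : a != 0.
  by apply: contraNneq hT0 => a0; rewrite TE a0 tofrac0 mul0r.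
have gcd_dvd m c : c \in G m -> c != 0 -> (gcdn d s %| m)%N.
  move=> cG c0; have [i [c' [lei c'G c'P _]]] := generator_factor cG c0.
  rewrite -(subnK lei) dvdn_add //; last by rewrite dvdn_mull ?dvdn_gcdl.
  exact: dvdn_trans (dvdn_gcdr _ _) (degree_dvd c'G c'P).
rewrite /coprime -dvdn1 -(dvdn_addl _ (gcd_dvd _ _ bG b0)).
exact: gcd_dvd aG a0.
Qed.

(** A nonzero function in the maximal ideal is [x ^+ i * p' / q] with [p'], [q] outside [P] and
    [i > 0]. Since [s] divides the degrees of [p'] and [q], it divides [i * d], hence [i]; so
    [x ^+ s] can be split off. *)
Lemma generator_uniformizer : exists m b c,
  [/\ b \in G m, b \notin P, c \in G (s * d + m)%N, c \notin P &
      uniformizer P ((x ^+ s * b)%:F / c%:F)].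
Proof.
have [M hM] := degrees_large; have s0 := ngcd_degrees_gt0.
have [|//|b bG bP] := hM (M * s)%N; first by rewrite leq_pmulr.
  exact: dvdn_mull.
have [|//|c cG cP] := hM (s * d + M * s)%N.
- by rewrite (leq_trans _ (leq_addl _ _)) // leq_pmulr.
- by apply: dvdn_add; [exact: dvdn_mulr | exact: dvdn_mull].
exists (M * s)%N, b, c; split=> //; rewrite /uniformizer.
have xsG : x ^+ s \in G (s * d)%N by exact: gradedX.
have xsP : x ^+ s \in P by rewrite -(prednK s0) exprS (prime_idealMl pP) // generator_in.
apply/seteqP; split=> f.
  move=> [n [p [q [pG pP' qG qP ->]]]].
  have [->|p0] := eqVneq p 0.
    by exists 0; [exact: local0 | rewrite mulr0 tofrac0 mul0r].
  have [i [p' [lei p'G p'P pE]]] := generator_factor pG p0.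
  have les : (s <= i)%N.
    have i0 : (0 < i)%N.
      rewrite lt0n; apply: contraNneq p'P => i0.
      by move: pP'; rewrite pE i0 expr0 mul1r.
    apply: dvdn_leq => //; rewrite -(Gauss_dvdl i (p := d)); last first.
      by rewrite coprime_sym coprime_degrees.
    by rewrite -(dvdn_subr lei) ?(degree_dvd qG qP) ?(degree_dvd p'G p'P).
  exists ((x ^+ (i - s) * p' * c)%:F / (b * q)%:F).
    apply: (@local_frac _ _ P (M * s + n)); last 1 first.
    - by rewrite (prime_idealM pP) negb_or bP.
    - have -> : (M * s + n = (i - s) * d + (n - i * d) + (s * d + M * s))%N.
        rewrite -subn_mul_split // addnA subnK 1?addnC //.
        by apply: leq_trans lei; rewrite leq_mul2r les orbT.
      by apply: gradedM => //; apply: gradedM => //; exact: gradedX.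
    - exact: gradedM.
  rewrite mulf_div -!tofracM; apply/eqP; rewrite eqr_div; last 2 first.
  - by rewrite tofrac_eq0 !mulf_neq0 ?(notin_neq0 pP).
  - by rewrite tofrac_eq0 (notin_neq0 pP).
  rewrite -!tofracM tofrac_eq pE -{2}(subnKC les) exprD.
  by rewrite uniformizer_identity.
move=> [h hO <-]; rewrite mulrC; apply: local_maxM => //.
apply: max_frac cG cP _; first by apply: gradedM.
by rewrite (prime_idealMl pP).
Qed.

(** The uniformizer [x ^+ s * b / c] has order 1, and [b], [c] do not vanish at [P]. *)
Lemma sec_ord_generator : s%:R * sec P d x = 1.
Proof.
have [m [b [c [bG bP cG cP ut]]]] := generator_uniformizer.
have b0 := notin_neq0 pP bP; have c0 := notin_neq0 pP cP.
have xsb0 : x ^+ s * b != 0 by rewrite mulf_neq0 ?expf_neq0.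
have t0 : (x ^+ s * b)%:F / c%:F != 0 by rewrite mulf_neq0 ?invr_eq0 ?tofrac_eq0.
have xsG : x ^+ s \in G (s * d)%N by exact: gradedX.
have xsbG : x ^+ s * b \in G (s * d + m)%N by exact: gradedM.
have := sec_frac P xsbG cG xsb0 c0.
rewrite (ord_eq hG ut t0 (n := 1) (local_unit1 hG P)) ?mul1r //.
rewrite (sec_notin cG cP) subr0.
rewrite (secM P xsG bG (expf_neq0 _ x0) b0).
rewrite (sec_notin bG bP) addr0.
by rewrite secX.
Qed.

Lemma generator_notin Q : Q <> P -> x \notin Q.
Proof.
move=> QP; apply: contra_notN QP => xQ; apply/esym/proj_point_eq => r /hPx[c ->].
exact: prime_idealMr (point_prime Q) _ _ xQ.
Qed.

Lemma generatorX_notin Q n : Q <> P -> x ^+ n \notin Q.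
Proof. by move=> /generator_notin xQ; apply: prime_idealX => //; exact: point_prime. Qed.

Lemma sec_ord_generatorE Q : s%:R * sec Q d x = (Q == P)%:R.
Proof.
have [->|/eqP QP] := eqVneq Q P; first exact: sec_ord_generator.
rewrite (sec_notin xG) ?mulr0 //.
exact: generator_notin.
Qed.

Lemma generator_lin_equiv : lin_equiv (scale_div (s * d) D) (point_div P).
Proof.
have xsG : x ^+ s \in G (s * d)%N by exact: gradedX.
have xs0 : x ^+ s != 0 by rewrite expf_neq0.
have Kg := sec_ff hG hT hT0 xsG; have g0 := sec_neq0 hT0 (s * d) xs0.
exists ((x ^+ s)%:F / T ^+ (s * d))^-1; split.
- exact: ffV.
- by rewrite invr_eq0.
apply/funext => Q; rewrite /sub_div /principal_div (ordV hG hG0 hdim Q Kg g0).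
rewrite /scale_div /point_div -sec_ord_generatorE.
rewrite -(secX Q _ xG x0) /sec_ord rmorphN.
by rewrite opprD addrCA subrr addr0.
Qed.

(* Away from P, r in R_(jsd) vanishes like the function r / x ^ (j s).        *)
Lemma sec_ord_int Q j r : Q <> P -> r \in G (j * (s * d))%N -> r != 0 ->
  exists z : int, sec Q (j * (s * d)) r = z%:~R.
Proof.
move=> QP rG r0; have xG' : x ^+ (j * s) \in G (j * (s * d))%N.
  by rewrite mulnA; exact: gradedX.
exists (ord Q (r%:F / (x ^+ (j * s))%:F)).
rewrite (sec_frac Q rG xG') ?expf_neq0 //.
rewrite (sec_notin xG') ?subr0 //.
exact: generatorX_notin.
Qed.

Lemma sec_ord_succ Q j r (n : nat) : Q <> P -> r \in G (j * (s * d))%N -> r != 0 ->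
  n%:R < sec Q (j * (s * d)) r -> n.+1%:R <= sec Q (j * (s * d)) r.
Proof.
move=> QP rG r0; have [z ->] := sec_ord_int QP rG r0; exact: ratz_succ.
Qed.

(** In these degrees the orders away from [P] are integers, and multiplication by [x ^+ s] leads
    from one piece to the next. *)
Definition piece j : set R := [set r | r \in G (j * (s * d))%N].

Lemma piece_subspace j : subspace iota (piece j).
Proof.
split; rewrite /piece /=; first exact: graded0.
  by move=> a b; exact: gradedD.
by move=> c a; exact: gradedZ.
Qed.

Lemma piece_mul i j a b : piece i a -> piece j b -> piece (i + j) (a * b).
Proof. by rewrite /piece /= mulnDl; exact: gradedM. Qed.

Lemma piece_generator j : piece j (x ^+ (s * j)).
Proof. by rewrite /piece /= mulnA [(j * s)%N]mulnC; exact: gradedX. Qed.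

Lemma piece_point_div j r : piece j.+1 r -> r \in P ->
  exists2 r', piece j r' & r = x ^+ s * r'.
Proof.
move=> rG rP; have [->|r0] := eqVneq r 0.
  by exists 0; [exact: graded0 | rewrite mulr0].
have [i [r' [lei r'G r'P rE]]] := generator_factor rG r0.
have i0 : (0 < i)%N.
  rewrite lt0n; apply: contraNneq r'P => i0.
  by move: rP; rewrite rE i0 expr0 mul1r.
have les : (s <= i)%N.
  apply: dvdn_leq => //; rewrite -(Gauss_dvdl i (p := d)); last first.
    by rewrite coprime_sym coprime_degrees.
  rewrite -(dvdn_subr lei) ?(degree_dvd r'G r'P) //.
  by rewrite dvdn_mull // dvdn_mulr.
exists (x ^+ (i - s) * r'); last by rewrite rE mulrA -exprD subnKC.
rewrite /piece /=.
have -> : (j * (s * d) = (i - s) * d + (j.+1 * (s * d) - i * d))%N.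
  by rewrite -subn_mul_split // mulSn addKn.
by apply: gradedM => //; exact: gradedX.
Qed.

(** * Dimensions of the graded pieces *)

Definition has_dim (V : set R) n := indep iota V n /\ spanned iota V n.

Lemma has_dim_uniq V m n : has_dim V m -> has_dim V n -> m = n.
Proof.
move=> [Im Sm] [In Sn]; apply/eqP; rewrite eqn_leq.
by rewrite (indep_leq_spanned Im Sn) (indep_leq_spanned In Sm).
Qed.

(** The part of [piece j.+1] inside [P] is [x ^+ s] times [piece j], and the quotient by it is at
    most a line because the residue field at [P] is [k]. *)
Lemma piece_dim_step j n : has_dim (piece j) n ->
  ((exists2 a, piece j.+1 a & a \notin P) -> has_dim (piece j.+1) n.+1) /\
  (~ (exists2 a, piece j.+1 a & a \notin P) -> has_dim (piece j.+1) n).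
Proof.
move=> [Ij Sj]; pose W := [set r | piece j.+1 r /\ r \in P].
have [W0 WD WZ] : subspace iota W.
  have [p0 pD pZ] := piece_subspace j.+1; split.
  - by split=> //; exact: prime_ideal0.
  - move=> a b [aG aP] [bG bP]; split; first exact: pD.
    exact: prime_idealD.
  - move=> c a [aG aP]; split; first exact: pZ.
    exact: prime_idealMr.
have IW : indep iota W n.
  apply: (indep_mul (f := x ^+ s)) Ij; first exact: expf_neq0.
  move=> r rG; split.
    rewrite -[j.+1]add1n; apply: piece_mul => //; rewrite /piece /= mul1n.
    exact: gradedX.
  rewrite (prime_idealMl pP) // -(prednK ngcd_degrees_gt0) exprS.
  by rewrite (prime_idealMl pP) // generator_in.
have SW : spanned iota W n.
  by apply: spanned_mul Sj => r [rG rP]; exact: piece_point_div rG rP.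
split=> [[v vG vP]|none]; split.
- apply: (@indep_step _ _ _ W _ n v) => //; first by move=> r [].
  by case=> _; rewrite (negPf vP).
- apply: (@spanned_step _ _ _ W _ n v) => // r rG.
  have [z rz] := point_residue hG hG0 hfg rG vG vP.
  exists z; split=> //; apply: subspaceB (piece_subspace _) _ _ => //.
  by case: (piece_subspace j.+1) => _ _; apply.
- by apply: indepS IW => r [].
- have [w wW] := SW; exists w => r rG; apply: wW; split=> //.
  by apply: contrapT => /negP rP; apply: none; exists r.
Qed.

Lemma piece0_dim : has_dim (piece 0) 1.
Proof.
split.
  exists (fun=> 1) => [_|c]; first exact: grading1.
  rewrite /lincomb big_ord1 mulr1 => /eqP; rewrite fmorph_eq0 => /eqP c0 i.
  by rewrite ord1.
exists (fun=> 1) => r; rewrite /piece /= mul0n => /hG0[c ->].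
by exists (fun=> c); rewrite /lincomb big_ord1 mulr1.
Qed.

Lemma piece_dim_exists : exists H, forall j, has_dim (piece j) (H j).
Proof.
suff /choice[H HP] : forall j, exists n, has_dim (piece j) n by exists H.
elim=> [|j [n nj]]; first by exists 1%N; exact: piece0_dim.
have [h1 h2] := piece_dim_step nj.
by have [/h1|/h2] := pselect (exists2 a, piece j.+1 a & a \notin P);
  [exists n.+1|exists n].
Qed.

Lemma piece_dim : exists H j0, (forall j, has_dim (piece j) (H j)) /\
  forall j l, (j0 <= j)%N -> H (j + l)%N = (H j + l)%N.
Proof.
have [H HP] := piece_dim_exists; have [M hM] := degrees_large.
exists H, M; split=> // j l leM; elim: l => [|l IH]; first by rewrite !addn0.
rewrite !addnS; have [h1 _] := piece_dim_step (HP (j + l)%N).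
rewrite -IH; apply: has_dim_uniq (HP _) (h1 _).
apply: hM; last by rewrite dvdn_mull // dvdn_mulr.
have sd0 : (0 < s * d)%N by rewrite muln_gt0 ngcd_degrees_gt0.
by apply: leq_trans (leq_pmulr _ sd0); rewrite (leq_trans leM) // -addnS leq_addr.
Qed.

(* The list L stands for an effective divisor: points with multiplicities.    *)
Definition sections j (L : seq (proj_point G)) : set R :=
  [set r | piece j r /\
     forall Q, vanishing T D Q (j * (s * d)) (count_mem Q L)%:R r].

Lemma sections_subspace j L : subspace iota (sections j L).
Proof.
have [p0 pD pZ] := piece_subspace j; split.
- by split=> // Q; left.
- move=> a b [aG aL] [bG bL]; split; first exact: pD.
  by move=> Q; apply: (vanishingD hG hG0 hdim hT hT0 hDample hRD).
- move=> c a [aG aL]; split; first exact: pZ.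
  by move=> Q; apply: (vanishingZ hG hG0 hdim hT hT0 hDample hRD).
Qed.

Lemma sections_cons j Q L : sections j (Q :: L) `<=` sections j L.
Proof.
move=> r [rG rL]; split=> // Q'; have [->|le_r] := rL Q'; [by left|right].
by apply: le_trans le_r; rewrite ler_nat /= leq_addl.
Qed.

(** Simple zeros exist at good points, and orders away from [P] increase in integer steps. *)
Definition admissible (L : seq (proj_point G)) :=
  forall Q, Q \in L -> good_point Q /\ Q <> P.

Let sd_gt0 : (0 < s * d)%N.
Proof. by rewrite muln_gt0 ngcd_degrees_gt0. Qed.

(** The numerator of a uniformizer [a / b] has order 1 at [Q]; a power of [b], of order 0, brings
    its degree to a multiple of [s * d]. *)
Lemma exists_simple_zero Q : good_point Q -> exists j v,
  [/\ piece j v, v != 0 & sec Q (j * (s * d)) v = 1].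
Proof.
move=> [t ut t0]; have [m [a [b [aG aQ bG bQ tE]]]] := uniformizer_max hG ut.
have b0 := notin_neq0 (point_prime Q) bQ.
have a0 : a != 0 by apply: contraNneq t0 => a0; rewrite tE a0 tofrac0 mul0r.
have bX : b ^+ (s * d).-1 \in G ((s * d).-1 * m)%N by exact: gradedX.
have mE : (m + (s * d).-1 * m = m * (s * d))%N.
  by rewrite -mulSn prednK // mulnC.
exists m, (a * b ^+ (s * d).-1); split.
- by rewrite /piece /= -mE; exact: gradedM.
- by rewrite mulf_neq0 ?expf_neq0.
rewrite -mE secM ?expf_neq0 // (sec_notin bX) ?addr0; last first.
  by apply: prime_idealX => //; exact: point_prime.
have := sec_frac Q aG bG a0 b0.
rewrite -tE (ord_eq hG ut t0 (n := 1) (local_unit1 hG Q)) ?mul1r //.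
by rewrite (sec_notin bG bQ) subr0 => <-.
Qed.

(** Multiply one section per entry [p] of [L]: one with a simple zero if [p = Q], otherwise one
    vanishing at [p] but not at [Q]. *)
Lemma exists_exact_vanishing Q L : good_point Q -> admissible L -> exists j v,
  [/\ piece j v, v != 0,
      forall Q', (count_mem Q' L)%:R <= sec Q' (j * (s * d)) v &
      sec Q (j * (s * d)) v = (count_mem Q L)%:R].
Proof.
move=> gQ; elim: L => [|p L IH] aL.
  exists 0%N, 1; rewrite oner_neq0 /piece /= mul0n grading1 //.
  have sec1 Q' : sec Q' 0 1 = 0 by exact: (sec_ord1 hG T D).
  by rewrite sec1; split=> // Q'; rewrite sec1.
have [|j [v [vG v0 vL vQ]]] := IH.
  by move=> Q' Q'L; apply: aL; rewrite inE Q'L orbT.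
have [gp pP'] := aL p (mem_head _ _).
suff [i [u [uG u0 up uQ]]] : exists i u, [/\ piece i u, u != 0,
    1 <= sec p (i * (s * d)) u & sec Q (i * (s * d)) u = (p == Q)%:R].
  exists (i + j)%N, (u * v); split.
  - exact: piece_mul.
  - exact: mulf_neq0.
  - move=> Q'; rewrite mulnDl secM // /= natrD lerD //.
    have [<-//|_] := eqVneq p Q'; exact: sec_ge0.
  - by rewrite mulnDl secM // uQ vQ /= natrD.
have [pQ|/eqP pQ] := eqVneq p Q.
  have [i [u [uG u0 uQ]]] := exists_simple_zero gQ.
  by exists i, u; rewrite pQ uQ.
have [n [a [n0 aG ap aQ]]] := exists_separating hG pQ.
have a0 := notin_neq0 (point_prime Q) aQ.
have aXG : piece n (a ^+ (s * d)) by rewrite /piece /= [(n * _)%N]mulnC; exact: gradedX.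
exists n, (a ^+ (s * d)); split=> //.
- exact: expf_neq0.
- rewrite -[1]/(0.+1%:R); apply: sec_ord_succ => //; first exact: expf_neq0.
  apply: (sec_ord_in hG hG0 hdim hT hT0 hDample hRD) => //; last exact: expf_neq0.
  by rewrite -(prednK sd_gt0) exprS (prime_idealMl (point_prime p)).
- apply: sec_notin => //; apply: prime_idealX => //; exact: point_prime.
Qed.

(** For large [j], each further point [Q] cuts the space strictly: the section of
    [exists_exact_vanishing], times a power of [x], vanishes along [L] but not along [Q :: L]. *)
Lemma indep_sections L : admissible L -> exists J, forall j, (J <= j)%N ->
  forall n, indep iota (sections j L) n -> indep iota (piece j) (n + size L).
Proof.
elim: L => [|Q L IH] aL.
  by exists 0%N => j _ n; rewrite addn0; apply: indepS => r [].
have [|J hJ] := IH; first by move=> Q' Q'L; apply: aL; rewrite inE Q'L orbT.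
have [gQ QP] := aL Q (mem_head _ _).
have [|i [v [vG v0 vL vQ]]] := exists_exact_vanishing (L := L) gQ.
  by move=> Q' Q'L; apply: aL; rewrite inE Q'L orbT.
exists (maxn J i) => j; rewrite geq_max => /andP[leJ lei] n In.
rewrite /= addnS -addSn; apply: hJ => //.
have xjG := piece_generator (j - i); have xj0 : x ^+ (s * (j - i)) != 0 by rewrite expf_neq0.
have jE : (j * (s * d) = (j - i) * (s * d) + i * (s * d))%N by rewrite -mulnDl subnK.
apply: (@indep_step _ _ _ (sections j (Q :: L)) _ n (x ^+ (s * (j - i)) * v)) In.
- exact: sections_subspace.
- exact: sections_cons.
- split; first by have := piece_mul xjG vG; rewrite subnK.
  move=> Q'; right; rewrite jE secM //; apply: le_trans (vL Q') _.
  by rewrite lerDr sec_ge0.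
move=> [_ /(_ Q)[/eqP|]]; first by rewrite mulf_eq0 (negPf xj0) (negPf v0).
rewrite jE secM // vQ (sec_notin xjG) ?add0r /= ?eqxx ?ler_nat; first by rewrite ltnn.
exact: generatorX_notin.
Qed.

(** A further point [Q] costs at most one dimension: if [v] has the least order allowed at [Q], then
    [r / v] is regular at [Q], and subtracting its residue times [v] from [r] raises the order. *)
Lemma spanned_sections L : admissible L -> forall j n,
  spanned iota (sections j L) n -> spanned iota (piece j) (n + size L).
Proof.
elim: L => [|Q L IH] aL j n.
  rewrite addn0 => -[w wS]; exists w => r rG; apply: wS; split=> // Q.
  by have [->|r0] := eqVneq r 0; [left|right; exact: sec_ge0].
move=> Sn; rewrite /= addnS -addSn; apply: IH.
  by move=> Q' Q'L; apply: aL; rewrite inE Q'L orbT.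
have [gQ QP] := aL Q (mem_head _ _).
have sS := sections_subspace j.
suff [v vP] : exists v, forall r, sections j L r ->
    exists z : k, sections j (Q :: L) (r - iota z * v).
  exact: spanned_step vP Sn.
have [[v [vS vQ]]|none] :=
    pselect (exists v, sections j L v /\ ~ sections j (Q :: L) v); last first.
  exists 0 => r rS; exists 0; rewrite mulr0 subr0.
  by apply: contrapT => rQ; apply: none; exists r.
have [vG vL] := vS.
have v0 : v != 0.
  by apply: contra_notN vQ => /eqP ->; case: (sS (Q :: L)).
have secv : sec Q (j * (s * d)) v = (count_mem Q L)%:R.
  apply/eqP; rewrite eq_le; apply/andP; split; last first.
    by case: (vL Q) => // vz; rewrite vz eqxx in v0.
  rewrite leNgt; apply/negP => lt_v; apply: vQ; split=> // Q' /=.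
  have [<-|_] := eqVneq Q Q'; last exact: vL.
  by right; apply: sec_ord_succ.
exists v => r rS; have [rG rL] := rS.
have [->|r0] := eqVneq r 0.
  by exists 0; rewrite rmorph0 mul0r subr0; case: (sS (Q :: L)).
have rQ : (count_mem Q L)%:R <= sec Q (j * (s * d)) r.
  by case: (rL Q) => // rz; rewrite rz eqxx in r0.
have Krv : function_field G (r%:F / v%:F) by exact: ff_frac rG vG v0.
have rv0 : r%:F / v%:F != 0 by rewrite mulf_neq0 ?invr_eq0 ?tofrac_eq0.
have [|m [a [b [aG bG bQ rvE]]]] := ord_local hG hG0 hdim gQ Krv rv0.
  by rewrite -(ler0z rat) (sec_frac Q rG vG) // secv subr_ge0.
have [z zQ] := point_residue hG hG0 hfg aG bG bQ.
exists z; have zv : piece j (iota z * v) by case: (piece_subspace j) => _ _; apply.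
have rzS : sections j L (r - iota z * v).
  apply: subspaceB (sS L) rS _; case: (sS L) => _ _; exact.
have [rzG rzL] := rzS; split=> // Q'.
have [<-|ne] := eqVneq Q Q'; last by rewrite /= (negPf ne) add0n.
have [->|rz0] := eqVneq (r - iota z * v) 0; [by left|right].
rewrite /= eqxx; apply: sec_ord_succ => //.
rewrite -secv -subr_gt0 -(sec_frac Q rzG vG rz0 v0) ltr0z.
apply: (ord_gt0 hG hG0 hdim gQ); last first.
  by rewrite mulf_neq0 ?invr_eq0 ?tofrac_eq0.
have vF : v%:F != 0 by rewrite tofrac_eq0.
have bF := notin_frac0 bQ.
have -> : (r - iota z * v)%:F / v%:F = (a - iota z * b)%:F / b%:F.
  by rewrite !tofracB !mulrBl rvE !tofracM !mulfK.
apply: (@max_frac _ _ Q m) => //; apply: gradedB => //; exact: (gradedZ hG hG0 z bG).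
Qed.

(** The divisor of [f] is obtained as the longest list [L] below it. Multiplication by [f] embeds
    pieces into [sections _ L], and for this [L] every such section is divisible by [f]; the growth
    of [H] then gives both bounds on [size L]. *)
Lemma piece_divisor l f : piece l f -> f \notin P -> exists L, size L = l /\
  forall Q, sec Q (l * (s * d)) f = (count_mem Q L)%:R.
Proof.
move=> fG fP; have f0 := notin_neq0 pP fP.
have [H [j0 [HP HD]]] := piece_dim.
pose below L := forall Q, (count_mem Q L)%:R <= sec Q (l * (s * d)) f.
have below_adm L : below L -> admissible L.
  move=> bL Q QL; have f_gt0 : 0 < sec Q (l * (s * d)) f.
    by apply: lt_le_trans (bL Q); rewrite ltr0n -has_count has_pred1.
  split; first by have [] := sec_ord_gt0 hG hG0 hdim hT hT0 hDample hRD fG f0 f_gt0.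
  by move=> QP; move: f_gt0; rewrite QP (sec_notin fG fP) ltxx.
have size_le L : below L -> (size L <= l)%N.
  move=> bL; have [J hJ] := indep_sections (below_adm _ bL).
  pose j := maxn J j0; rewrite -(leq_add2l (H j)) -(HD j l) ?leq_maxr //.
  apply: indep_leq_spanned _ (proj2 (HP (j + l)%N)); apply: hJ.
    by rewrite (leq_trans (leq_maxl _ _) (leq_addr _ _)).
  apply: (indep_mul f0 _ (proj1 (HP j))) => r rG; split.
    by rewrite addnC; exact: piece_mul.
  move=> Q; have [->|r0] := eqVneq r 0; [by left; rewrite mulr0|right].
  by rewrite addnC mulnDl secM //; apply: le_trans (bL Q) _; rewrite lerDl sec_ge0.
pose good n := `[< exists2 L, below L & size L = n >].
have ex0 : exists n, good n.
  by exists 0%N; apply/asboolP; exists [::] => // Q; exact: sec_ge0.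
have good_le n : good n -> (n <= l)%N by move=> /asboolP[L /size_le + <-].
case: (ex_maxnP ex0 good_le) => n /asboolP[L bL <-] Lmax.
have LE Q : sec Q (l * (s * d)) f = (count_mem Q L)%:R.
  apply/eqP; rewrite eq_le bL andbT leNgt; apply/negP => ltQ.
  have QP : Q <> P.
    by move=> QP; move: ltQ; rewrite QP (sec_notin fG fP) ltrn0.
  (* By integrality, a strict inequality at [Q] leaves room for one more copy of [Q]. *)
  suff /Lmax : good (size L).+1 by rewrite ltnn.
  apply/asboolP; exists (Q :: L) => // Q' /=; have [<-|_] := eqVneq Q Q'; last exact: bL.
  exact: sec_ord_succ.
exists L; split=> //; apply/eqP; rewrite eqn_leq size_le //=.
rewrite -(leq_add2l (H j0)) -(HD j0 l) //.
apply: indep_leq_spanned (proj1 (HP _)) _; apply: spanned_sections.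
  exact: below_adm.
apply: (spanned_mul (f := f) _ (proj2 (HP j0))) => r [rG rL].
have [||h hG' rE] := sec_ord_div hG hG0 hdim hT hT0 hRD rG fG f0.
- by rewrite leq_mul2r leq_addl orbT.
- move=> r0 Q; rewrite LE; case: (rL Q) => // rz; by rewrite rz eqxx in r0.
by exists h => //; move: hG'; rewrite -mulnBl addnK.
Qed.

(** Write [a = x ^+ i * a'] with [a'] outside [P] of degree [l * s]. Then [s d] times the divisor of
    [a] is [i d P] plus [s] times the divisor of [a' ^+ d], which has degree [l]; the total is
    [i d + s l = n]. *)
Lemma section_divisor n a : a \in G n -> a != 0 -> exists L, size L = n /\
  forall Q, (s * d)%:R * sec Q n a = (count_mem Q L)%:R.
Proof.
move=> aG a0; have [i [a' [lei a'G a'P aE]]] := generator_factor aG a0.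
have /dvdnP[l lE] := degree_dvd a'G a'P.
have a'0 := notin_neq0 pP a'P.
have fG : piece l (a' ^+ d).
  by rewrite /piece /= mulnA -lE mulnC; exact: gradedX.
have [L [szL LE]] := piece_divisor fG (prime_idealX pP d a'P).
exists (nseq (i * d) P ++ flatten (nseq s L)); split.
  rewrite size_cat size_nseq size_flatten /shape map_nseq sumn_nseq szL -lE.
  by rewrite subnKC.
move=> Q; rewrite count_cat count_nseq count_flatten map_nseq sumn_nseq /=.
rewrite [X in sec Q X a](_ : n = i * d + (n - i * d))%N; last by rewrite subnKC.
rewrite aE secM ?expf_neq0 //; last exact: gradedX.
rewrite secX // natrD !natrM; have := LE Q.
have -> : (l * (s * d) = d * (n - i * d))%N by rewrite mulnA -lE mulnC.
rewrite secX // => <-; rewrite mulrDr eq_sym -(sec_ord_generatorE Q).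
congr (_ + _); last by rewrite -mulrA mulrC.
by rewrite mulrACA [RHS]mulrACA; congr (_ * _); rewrite mulrC.
Qed.

Lemma sum_count_mem (K : eqType) (L X : seq K) : uniq X -> {subset L <= X} ->
  (\sum_(i <- X) count_mem i L)%N = size L.
Proof.
move=> uX; elim: L => [|p L IH] LX; first by rewrite big1.
rewrite big_split /= IH; last by move=> q qL; apply: LX; rewrite inE qL orbT.
rewrite (bigD1_seq p) ?LX ?mem_head //= eqxx big1 // => q /negPf.
by rewrite eq_sym => ->.
Qed.

(** For [T = a / b], the divisor [D] is that of [a] minus that of [b]; multiplied by [s d] these
    have degrees [n + 1] and [n]. *)
Lemma degree_eq : degree D = 1 / (s * d)%:R.
Proof.
have [n [a [b [aG bG b0 TE]]]] := hT.
have a0 : a != 0.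
  by apply: contraNneq hT0 => a0; rewrite TE a0 tofrac0 mul0r.
have [La [szA LaE]] := section_divisor aG a0.
have [Lb [szB LbE]] := section_divisor bG b0.
have sdn0 : (s * d)%:R != 0 :> rat by rewrite pnatr_eq0 -lt0n.
have DE Q : D Q = ((count_mem Q La)%:R - (count_mem Q Lb)%:R) / (s * d)%:R.
  rewrite -LaE -LbE -mulrBr [_ * (_ - _)]mulrC mulfK // /sec_ord.
  have -> : a%:F / T ^+ (1 + n) = b%:F / T ^+ n.
    have bF : b%:F != 0 by rewrite tofrac_eq0.
    have -> : a%:F = T * b%:F by rewrite TE mulfVK.
    by rewrite exprD expr1 -mulf_div mulfV // mul1r.
  rewrite natrD; lra.
pose X := undup (La ++ Lb).
have inX Q : Q \in X = (Q \in La) || (Q \in Lb) by rewrite mem_undup mem_cat.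
have DX : degree D = \sum_(Q <- X) D Q.
  rewrite /degree (fsbigE X) ?undup_uniq //.
    by apply: eq_bigl => Q; rewrite in_setT.
  move=> Q _; rewrite inX negb_or => /andP[/count_memPn Qa /count_memPn Qb].
  by rewrite DE Qa Qb subrr mul0r.
rewrite DX (eq_bigr _ (fun Q _ => DE Q)) -mulr_suml sumrB -!natr_sum.
rewrite !sum_count_mem ?undup_uniq ?szA ?szB ?natrD ?addrK //.
- by move=> Q QL; rewrite inX QL orbT.
- by move=> Q QL; rewrite inX QL.
Qed.

End PrincipalPoint.

(** * Homogeneous prime elements *)

Section HomogeneousPrimeElement.
Variables (k : closedFieldType) (R : idomainType) (iota : {rmorphism k -> R}).
Variable (G : nat -> {pred R}).
Hypotheses (hG : grading G)
  (hG0 : forall r : R, r \in G 0%N <-> exists c : k, r = iota c)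
  (hdim : krull_dim R 2).
Variables (d : nat) (x : R).
Hypotheses (hd : (0 < d)%N) (xG : x \in G d).

Lemma principalP (a : R) : a \in principal x <-> exists c, a = c * x.
Proof. by split=> [/asboolP|ac] //; apply/asboolP. Qed.

Lemma principal_homogeneous : homogeneous_ideal G (principal x).
Proof.
apply: (@hcomp_homogeneous _ _ hG (principal x)) => _ /principalP[c ->] i.
rewrite mulrC (hcompMl hG _ _ xG).
apply/principalP; case: ifP => _; first by exists 0; rewrite mul0r.
by exists (hcomp hG c)`_(i - d); rewrite mulrC.
Qed.

Lemma horner_root (I : {pred R}) (p : {poly k}) : prime_ideal I -> p != 0 ->
  (map_poly iota p).[x] \in I -> exists z, x - iota z \in I.
Proof.
move=> pI p0 pxI; have szp : (size p).-1.+1 = size p by rewrite prednK // size_poly_gt0.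
have [||z] := hompoly_root (iota := iota) (a := x) (N := (size p).-1) pI (prime_ideal1 pI) p0.
- by rewrite szp.
- rewrite /hompoly szp; move: pxI; rewrite horner_coef size_map_poly.
  by under eq_bigr do rewrite coef_map; under [in X in _ -> X]eq_bigr do rewrite expr1n mulr1.
by rewrite mulr1; exists z.
Qed.

(* If R_+ = (x) then R = k[x], where nonzero primes are maximal.              *)
Lemma principal_neq_irrelevant : exists n a,
  [/\ (0 < n)%N, a \in G n & a \notin principal x].
Proof.
apply: contrapT => none.
have inx n a : (0 < n)%N -> a \in G n -> a \in principal x.
  by move=> n0 aG; apply/negPn/negP => ax; apply: none; exists n, a.
pose ev (p : {poly k}) := (map_poly iota p).[x].
have evG n a : a \in G n -> exists p, a = ev p.
  elim/ltn_ind: n a => n IH a aG; have [az|a0] := eqVneq a 0.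
    by exists 0; rewrite az /ev rmorph0 horner0.
  have [n0|n0] := posnP n.
    move: aG; rewrite n0 => /hG0[c ->]; exists c%:P.
    by rewrite /ev map_polyC hornerC.
  have /principalP[c aE] := inx n a n0 aG; rewrite mulrC in aE.
  have [c' c'G [led ->]] := graded_quotient hG aG xG a0 aE.
  have [|p ->] := IH (n - d)%N _ c' c'G; first by rewrite ltn_subrL hd.
  by exists ('X * p); rewrite /ev rmorphM /= map_polyX hornerM hornerX.
have evR r : exists p, r = ev p.
  rewrite (hcomp_sum hG r).
  apply: (big_ind (fun r => exists p, r = ev p)) => [|_ _ [p ->] [q ->]|i _].
  - by exists 0; rewrite /ev rmorph0 horner0.
  - by exists (p + q); rewrite /ev rmorphD hornerD.
  - exact: evG (hcomp_in hG r i).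
have [[C [pC sC]] _] := hdim.
have [C01 nC10] := sC 0%N isT; have [C12 nC21] := sC 1%N isT.
have [pC0 pC1 pC2] : [/\ prime_ideal (C 0%N), prime_ideal (C 1%N) & prime_ideal (C 2)].
  by split; apply: pC.
have [r rC1 rC0] : exists2 r, r \in C 1%N & r \notin C 0%N.
  apply: contrapT => noner; apply: nC10 => r rC1; apply/negPn/negP => rC0.
  by apply: noner; exists r.
have [p rE] := evR r.
have p0 : p != 0.
  apply: contraNneq rC0 => pz; rewrite rE pz /ev rmorph0 horner0.
  exact: prime_ideal0.
have [|z zC1] := horner_root pC1 p0; first by rewrite -/(ev p) -rE.
(* Modulo [x - iota z], which lies in [C 1], every [u] is a constant; for [u] in [C 2] the constant
   must be 0, so [u] lies in [C 1]. *)
apply: nC21 => u uC2; have [q uE] := evR u.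
have /factor_theorem[q' qE] : root (q - q.[z]%:P) z.
  by rewrite rootE !hornerE subrr.
have uE' : u = ev q' * (x - iota z) + iota q.[z].
  rewrite uE -[q in LHS](subrK q.[z]%:P) qE /ev rmorphD rmorphM /= hornerD hornerM.
  by rewrite rmorphB /= map_polyX !map_polyC !hornerE.
have mC1 : ev q' * (x - iota z) \in C 1%N by exact: prime_idealMr.
have [qz|qz] := eqVneq q.[z] 0; first by rewrite uE' qz rmorph0 addr0.
have := iota_notin iota pC2 qz; rewrite -[iota _](addKr (ev q' * (x - iota z))).
by rewrite -uE' addrC prime_idealB // C12.
Qed.

Hypotheses (xprime : prime_element x).

Lemma principal_in_Proj : in_Proj G (principal x).
Proof.
split; [by case: xprime | exact: principal_homogeneous |].
exact: principal_neq_irrelevant.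
Qed.

Lemma principal_closed I : in_Proj G I -> {subset principal x <= I} ->
  {subset I <= principal x}.
Proof.
have [x0 px] := xprime; apply: (prime_below_Proj hG hG0 hdim px x0).
by apply/principalP; exists 1; rewrite mul1r.
Qed.

Definition principal_point := ProjPoint principal_in_Proj principal_closed.

End HomogeneousPrimeElement.

(** * Sections whose divisor is a single point *)

Section PrimeSection.
Variables (k : closedFieldType) (R : idomainType) (iota : {rmorphism k -> R}).
Variable (G : nat -> {pred R}).
Hypotheses (hG : grading G)
  (hG0 : forall r : R, r \in G 0%N <-> exists c : k, r = iota c)
  (hdim : krull_dim R 2).
Variables (T : {fraction R}) (D : proj_point G -> rat).
Hypotheses (hT : homog_frac G 1 T) (hT0 : T != 0)
  (hDample : ample D) (hRD : section_ring D T).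
Variables (d : nat) (x : R) (P : proj_point G).
Hypotheses (hd : (0 < d)%N) (xG : x \in G d) (x0 : x != 0)
  (secx : forall Q, sec_ord T D Q d x = (Q == P)%:R)
  (hP : ~ frac_support D P).
Local Notation sec := (sec_ord T D).

Lemma divisor_point_in : good_point P /\ x \in P.
Proof.
have secP : 0 < sec P d x by rewrite secx eqxx.
exact: (sec_ord_gt0 hG hG0 hdim hT hT0 hDample hRD xG x0 secP).
Qed.

(** Since [D P] is an integer, so is the order, and it is positive. *)
Lemma sec_ord_ge1 n a : a \in G n -> a \in P -> a != 0 -> 1 <= sec P n a.
Proof.
move=> aG aP a0; have [gP _] := divisor_point_in.
have /intrP[z zE] : D P \is a Num.int by apply: contrapT => /negP DP; exact: hP.
have := sec_ord_in hG hG0 hdim hT hT0 hDample hRD gP aG aP a0.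
rewrite /sec_ord zE -[n%:R]/((n%:Z)%:~R) -intrM -intrD -[1]/(1%:~R).
by rewrite ltr0z ler_int gtz0_ge1.
Qed.

(* If n < d, then a ^ d / x ^ n would be a constant, so d * ord_P a = n < d.  *)
Lemma divisor_point_div n a : a \in G n -> a \in P -> exists c, a = c * x.
Proof.
move=> aG aP; have [->|a0] := eqVneq a 0; first by exists 0; rewrite mul0r.
have a1 := sec_ord_ge1 aG aP a0.
have le_xa Q : sec Q d x <= sec Q n a.
  rewrite secx; have [->//|_] := eqVneq Q P.
  exact: (sec_ord_ge0 hT0 hRD).
have [ledn|ltnd] := leqP d n.
  have [//|h _ ->] := sec_ord_div hG hG0 hdim hT hT0 hRD aG xG x0 ledn.
  by exists h; rewrite mulrC.
exfalso.
have adG : a ^+ d \in G (d * n)%N by exact: gradedX.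
have xnG : x ^+ n \in G (d * n)%N by rewrite mulnC; exact: gradedX.
have xn0 : x ^+ n != 0 by rewrite expf_neq0.
have secX := sec_ordX hG hG0 hdim D hT hT0.
have sec_xn Q : sec Q (d * n) (x ^+ n) = n%:R * (Q == P)%:R.
  by rewrite mulnC secX // secx.
have [|h hGr aE] := sec_ord_div hG hG0 hdim hT hT0 hRD adG xnG xn0 (leqnn _).
  move=> _ Q; rewrite sec_xn secX // -secx.
  apply: (le_trans (y := d%:R * sec Q d x)).
    by rewrite ler_wpM2r ?secx ?ler0n // ler_nat ltnW.
  by rewrite ler_wpM2l.
rewrite subnn in hGr.
have h0 : h != 0.
  by apply: contraNneq (expf_neq0 d a0) => hz; rewrite aE hz mulr0.
have := secX P _ d _ aG a0; rewrite aE -[(d * n)%N]addn0.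
rewrite (sec_ordM hG hG0 hdim D hT hT0 P xnG hGr xn0 h0) sec_xn eqxx mulr1.
have -> : sec P 0 h = 0.
  apply: (sec_ord_notin hG hG0 hdim hT hT0 hDample hRD hGr).
  exact: (graded0_notin hG0 (point_prime P) hGr h0).
rewrite addr0 => E; have : (n%:R < d%:R :> rat) by rewrite ltr_nat.
by rewrite E ltNge ler_peMr.
Qed.

Lemma divisor_pointE a : a \in P <-> exists c, a = c * x.
Proof.
split=> [aP|[c ->]]; last first.
  by apply: prime_idealMr (point_prime P) _ _ _; case: divisor_point_in.
rewrite (hcomp_sum hG a).
apply: (big_ind (fun r => exists c, r = c * x)) => [|_ _ [u ->] [v ->]|i _].
- by exists 0; rewrite mul0r.
- by exists (u + v); rewrite mulrDl.
apply: divisor_point_div (hcomp_in hG a i) _.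
exact: homogeneous_hcomp (point_homogeneous P) aP i.
Qed.

Lemma principal_eq_point : principal x = point_ideal P.
Proof.
apply/funext => a; apply/idP/idP.
  by move=> /principalP/divisor_pointE.
by move=> /divisor_pointE/principalP.
Qed.

End PrimeSection.

Theorem theorem1p1 (k : closedFieldType) (R : idomainType)
  (iota : {rmorphism k -> R}) (G : nat -> {pred R})
  (hG : grading G)
  (hG0 : forall r : R, r \in G 0%N <-> exists c : k, r = iota c)
  (hfg : fin_gen_algebra iota)
  (hirr : irredundant G (pred1 0))
  (hnormal : normal_domain R)
  (hdim : krull_dim R 2)
  (T : {fraction R}) (hT : homog_frac G 1 T) (hT0 : T != 0)
  (D : proj_point G -> rat) (hDfin : finite_support_div D) (hDample : ample D)
  (hRD : section_ring D T)
  (d : nat) (hd : (0 < d)%N) :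
  (forall x : R, x \in G d -> prime_element x ->
     let s := ngcd (quot_degrees G (principal x)) in
     [/\ coprime d s,
         exists P : proj_point G, lin_equiv (scale_div (s * d) D) (point_div P) &
         degree D = 1 / (s * d)%:R])
  /\
  (forall P : proj_point G,
     lin_equiv (scale_div d D) (point_div P) -> ~ frac_support D P ->
     forall g : {fraction R}, function_field G g -> g != 0 ->
       principal_div g = sub_div (point_div P) (scale_div d D) ->
       exists x : R, [/\ x%:F = g * T ^+ d, x \in G d,
         prime_element x & irredundant G (principal x)]).
Proof.
split=> [x xG xprime s|P _ hP g Kg g0 gdiv].
  have [x0 _] := xprime.
  pose P := principal_point hG hG0 hdim hd xG xprime.
  have hPx a : a \in P <-> exists c, a = c * x by exact: principalP.
  split.
  - exact: (coprime_degrees hG hT hT0 hd xG hPx).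
  - exists P.
    exact: (generator_lin_equiv hG hG0 hdim hT hT0 hDample hRD hd xG x0 hPx).
  - exact: (degree_eq hG hG0 hfg hdim hT hT0 hDample hRD hd xG x0 hPx).
have gD Q : (ord Q g)%:~R + d%:R * D Q = (Q == P)%:R.
  have := congr1 (fun E : proj_point G -> rat => E Q) gdiv.
  by rewrite /principal_div /sub_div /scale_div /point_div => ->; rewrite subrK.
(* The divisor of [g] plus [d D] is the point [P], which is effective, so [g T^d] lies in [R]. *)
have [|x xG xE] := (hRD d (g * T ^+ d)).2.
  exists g => //; split=> //; right => Q.
  by rewrite /principal_div /scale_div gD ler0n.
have Td : T ^+ d != 0 by rewrite expf_neq0.
have x0 : x != 0 by rewrite -tofrac_eq0 -xE mulf_neq0.
have secx Q : sec_ord T D Q d x = (Q == P)%:R.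
  by rewrite /sec_ord -xE mulfK.
have xP := principal_eq_point hG hG0 hdim hT hT0 hDample hRD xG x0 secx hP.
have hPx := divisor_pointE hG hG0 hdim hT hT0 hDample hRD xG x0 secx hP.
exists x; split=> //.
  by split=> //; rewrite xP; exact: point_prime.
(* The order of [x] at [P] is 1, and [s] times it is 1; hence [s = 1]. *)
have := sec_ord_generator hG hG0 hdim hT hT0 hDample hRD hd xG x0 hPx.
rewrite secx eqxx mulr1 /irredundant xP => /eqP.
by rewrite -[1]/(1%:R) eqr_nat => /eqP.
Qed.
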